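(* Let $d\ge1$, $p\in(0,1)$, $\overline p=1-p$, $S\sim\mathrm{Ber}(p)$, and $(X\vert S=k)\sim\mathcal N(\mu_k,\Sigma_k)$ for $k\in\{0,1\}$, where $\mu_k\in\mathbb R^d$ and $\Sigma_k\in\mathbb R^{d\times d}$ is a positive definite covariance matrix. Let $\sigma>0$ and $X^\sigma=X+\sigma Z$ with $Z\sim\mathcal N(0,I)$ independent of $(X,S)$. Let $\mathcal H=\{x\mapsto s(a^{\mathrm T}x+b'):a\in\mathbb R^d,b'\in\mathbb R\}$. Let $\tilde\Sigma_k:=\Sigma_k+\sigma^2I$, $\mu_d:=\mu_1-\mu_0$, $$A=\tfrac12\big(\tilde\Sigma_0^{-1}-\tilde\Sigma_1^{-1}\big),\qquad b=\tilde\Sigma_1^{-1}\mu_1-\tilde\Sigma_0^{-1}\mu_0,$$ $$c=\tfrac12\mu_0^{\mathrm T}\tilde\Sigma_0^{-1}\mu_0-\tfrac12\mu_1^{\mathrm T}\tilde\Sigma_1^{-1}\mu_1+\tfrac12\log\Big(\frac{|\tilde\Sigma_0|}{|\tilde\Sigma_1|}\Big)+\log\Big(\frac p{\overline p}\Big),$$ $$M_k:=\sum_{j=1}^d\lambda_j^{(k)}+b^{\mathrm T}\mu_k+\mu_k^{\mathrm T}A\mu_k+c,\qquad V_k:=\sum_{j=1}^d\Big(2(\lambda_j^{(k)})^2+(u_j^{(k)})^2\Big),$$ where $\lambda_1^{(k)},\dots,\lambda_d^{(k)}$ are the eigenvalues of $\tilde\Sigma_k^{1/2}A\tilde\Sigma_k^{1/2}$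 with corresponding (orthonormal) eigenvectors as the columns of a matrix $Q_k$, i.e. $Q_k^{\mathrm T}\tilde\Sigma_k^{1/2}A\tilde\Sigma_k^{1/2}Q_k=\mathrm{diag}(\lambda_1^{(k)},\dots,\lambda_d^{(k)})$, and $u^{(k)}=(u_1^{(k)},\dots,u_d^{(k)})^{\mathrm T}=Q_k^{\mathrm T}\tilde\Sigma_k^{1/2}(b+2A\mu_k)$. Then $$\epsilon_A\le\epsilon_A^{\mathrm{CCG}}:=\frac14\Big(\mathrm{VAR}_1-\mathrm{COV}\,\mathrm{VAR}_2^{-1}\,\mathrm{COV}^{\mathrm T}\Big),$$ where $$\mathrm{VAR}_1=pV_1+\overline pV_0+p\overline p(M_1-M_0)^2,$$ $$\begin{aligned}\mathrm{COV}=\ &2p\mu_1^{\mathrm T}A\Sigma_1+2\overline p\mu_0^{\mathrm T}A\Sigma_0+2\sigma^2[p\mu_1+\overline p\mu_0]^{\mathrm T}A\\&+p\overline p\big[\mathrm{tr}(A(\Sigma_1-\Sigma_0))+\mu_1^{\mathrm T}A\mu_1-\mu_0^{\mathrm T}A\mu_0\big]\mu_d^{\mathrm T}+b^{\mathrm T}\big[p\Sigma_1+\overline p\Sigma_0+\sigma^2I+p\overline p\mu_d\mu_d^{\mathrm T}\big],\end{aligned}$$ $$\mathrm{VAR}_2=p\Sigma_1+\overline p\Sigma_0+p\overline p\mu_d\mu_d^{\mathrm T}+\sigma^2I.$$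
   Context: $s(z)=1/(1+e^{-z})$ is the sigmoid function; $|M|$ is the determinant of a matrix $M$; $M^{1/2}$ is the symmetric positive definite square root. $\eta^\sigma(x)=\mathbb E[S\vert X^\sigma=x]$. $h^*_{\mathcal H}\in\arg\min_{h\in\mathcal H}\mathbb E[(S-h(X^\sigma))^2]$ denotes a minimizer over $\mathcal H$ (the minimum is assumed attained), and $\epsilon_A:=\mathbb E[(\eta^\sigma(X^\sigma)-h^*_{\mathcal H}(X^\sigma))^2]$. The subscript in $\mu_d$ is just a label (for ''difference''), unrelated to the dimension $d$. *)

(* Defs.v *)
From HB Require Import structures.
From mathcomp Require Import all_boot all_order all_algebra.
From mathcomp Require Import all_classical all_reals all_analysis.

Set Implicit Arguments.
Unset Strict Implicit.
Unset Printing Implicit Defensive.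

Import Order.TTheory GRing.Theory Num.Theory.
Import numFieldNormedType.Exports.

Local Open Scope classical_set_scope.
Local Open Scope ring_scope.

Definition measure_matrix_display : measure_display -> measure_display.
Proof. exact. Qed.

(* Matrices carry the sigma-algebra generated by the entries; for real entries
   this is the Borel sigma-algebra. *)
Section measurable_matrix.
Context {disp : measure_display} {T : measurableType disp}.
Variables m n : nat.

Definition matrix_cylinders : set (set 'M[T]_(m, n)) :=
  \bigcup_(ij in [set: 'I_m * 'I_n])
    preimage_set_system setT (fun M : 'M[T]_(m, n) => M ij.1 ij.2) measurable.

Let matrix_measurable : set (set 'M[T]_(m, n)) := <<s matrix_cylinders >>.

Let matrix_set0 : matrix_measurable set0.
Proof. exact: sigma_algebra0. Qed.

Let matrix_setC A : matrix_measurable A -> matrix_measurable (~` A).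
Proof. exact: sigma_algebraC. Qed.

Let matrix_bigcup (F : (set 'M[T]_(m, n))^nat) :
  (forall i, matrix_measurable (F i)) -> matrix_measurable (\bigcup_i F i).
Proof. exact: sigma_algebra_bigcup. Qed.

HB.instance Definition _ := @isMeasurable.Build (measure_matrix_display disp)
  'M[T]_(m, n) matrix_measurable matrix_set0 matrix_setC matrix_bigcup.

Lemma measurable_entry i j :
  measurable_fun [set: 'M[T]_(m, n)] (fun M : 'M[T]_(m, n) => M i j).
Proof.
move=> _ Y mY; rewrite setTI; apply: sub_sigma_algebra.
by exists (i, j) => //; exists Y => //; rewrite setTI.
Qed.

Lemma measurable_fun_matrixP disp' (U : measurableType disp')
    (f : U -> 'M[T]_(m, n)) :
  measurable_fun [set: U] f <->
  forall i j, measurable_fun [set: U] (fun x => f x i j).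
Proof.
split=> [mf i j|mf].
  exact: (measurableT_comp (measurable_entry i j) mf).
apply: (@measurability _ _ _ _ _ _ matrix_cylinders) => //.
move=> _ [_ [[i j] _ [Y mY <-]] <-].
rewrite !setTI -[X in measurable X]setTI; exact: (mf i j measurableT Y mY).
Qed.

End measurable_matrix.

Section lebesgue_measure_cV.
Variable R : realType.

(* (x, v) : R * R^n |-> (x, v_0, ..., v_(n-1)) : R^(n+1) *)
Definition cV_cons n (xv : measurableTypeR R * 'cV[R]_n) : 'cV[R]_n.+1 :=
  col_mx (xv.1%:M : 'M[R]_1) xv.2.

Lemma measurable_cV_cons n : measurable_fun setT (@cV_cons n).
Proof.
apply/measurable_fun_matrixP => i j; rewrite [j]ord1.
case: (split_ordP (i : 'I_(1 + n))) => k ->.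
  rewrite (_ : (fun _ => _) = fst) ?[k]ord1//.
  by apply/funext => -[x v]; rewrite [LHS]col_mxEu mxE mulr1n.
rewrite (_ : (fun _ => _) = (fun v : 'cV[R]_n => v k 0) \o snd).
  by apply: measurableT_comp => //; exact: measurable_entry.
by apply/funext => -[x v]; exact: col_mxEd.
Qed.

HB.instance Definition _ n := isMeasurableFun.Build _ _ _ _ (@cV_cons n)
  (@measurable_cV_cons n).

Definition cV_uncons n (v : 'cV[R]_n.+1) : measurableTypeR R * 'cV[R]_n :=
  (v 0 0, \col_i v (lift 0 i) 0).

Lemma measurable_cV_uncons n : measurable_fun setT (@cV_uncons n).
Proof.
apply: measurable_fun_pair; first exact: measurable_entry.
apply/measurable_fun_matrixP => i j.
rewrite (_ : (fun _ => _) = fun v : 'cV[R]_n.+1 => v (lift 0 i) 0).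
  exact: measurable_entry.
by apply/funext => v; rewrite mxE.
Qed.

Lemma cV_consK n : cancel (@cV_cons n) (@cV_uncons n).
Proof.
move=> [x v]; rewrite /cV_uncons; congr pair.
  transitivity (cV_cons (x, v) (lshift n (0 : 'I_1)) 0).
    by congr (cV_cons _ _ _); exact/val_inj.
  by rewrite [LHS]col_mxEu mxE mulr1n.
apply/colP => i; rewrite mxE.
transitivity (cV_cons (x, v) (rshift 1 i) 0); last exact: col_mxEd.
by congr (cV_cons _ _ _); exact/val_inj.
Qed.

Lemma cV_unconsK n : cancel (@cV_uncons n) (@cV_cons n).
Proof.
move=> v; apply/colP => i; case: (split_ordP (i : 'I_(1 + n))) => k ->.
  rewrite [LHS]col_mxEu mxE [k]ord1 mulr1n; congr (v _ _); exact/val_inj.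
by rewrite [LHS]col_mxEd mxE; congr (v _ _); exact/val_inj.
Qed.

Section step.
Variables (n : nat) (leb : {sigma_finite_measure set 'cV[R]_n -> \bar R}).

Definition lebesgue_cV_step : set 'cV[R]_n.+1 -> \bar R :=
  pushforward (lebesgue_measure \x leb)%E (@cV_cons n).

Let step0 : lebesgue_cV_step set0 = 0%E.
Proof. exact: (measure0 (pushforward _ _)). Qed.

Let step_ge0 A : (0 <= lebesgue_cV_step A)%E.
Proof. exact: (measure_ge0 (pushforward _ _)). Qed.

Let step_sigma_additive : semi_sigma_additive lebesgue_cV_step.
Proof. exact: (@measure_semi_sigma_additive _ _ _ (pushforward _ _)). Qed.

HB.instance Definition _ := isMeasure.Build _ _ _ lebesgue_cV_step
  step0 step_ge0 step_sigma_additive.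

Let lebesgue_cV_step_sigma_finite : sigma_finite setT lebesgue_cV_step.
Proof.
have [F TF Foo] : sigma_finite setT (lebesgue_measure \x leb)%E.
  have /sigma_finiteP[F [TF ndF Foo]] := sigma_finiteT (@lebesgue_measure R).
  have /sigma_finiteP[G [TG ndG Goo]] := sigma_finiteT leb.
  exists (fun i => F i `*` G i).
    rewrite -setXTT TF TG predeqE => -[x y]; split.
      move=> [/= [i _ Fix] [j _ Gjy]]; exists (maxn i j) => //; split.
      - by move: x Fix; exact/subsetPset/ndF/leq_maxl.
      - by move: y Gjy; exact/subsetPset/ndG/leq_maxr.
    by move=> [i _ []/= ? ?]; split; exists i.
  move=> i; have [? ?] := Foo i; have [? ?] := Goo i.
  split; first exact: measurableX.
  by rewrite product_measure1E// lte_mul_pinfty// ge0_fin_numE.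
exists (fun i => @cV_uncons n @^-1` F i).
  by rewrite -preimage_bigcup -TF preimage_setT.
move=> i; have [mF Fi] := Foo i; split.
  by rewrite -[X in measurable X]setTI; exact: measurable_cV_uncons.
rewrite /lebesgue_cV_step /pushforward -comp_preimage.
rewrite (_ : @cV_uncons n \o @cV_cons n = id) ?preimage_id//.
by apply/funext => x; exact: cV_consK.
Qed.

HB.instance Definition _ := Measure_isSigmaFinite.Build _ _ _
  lebesgue_cV_step lebesgue_cV_step_sigma_finite.

End step.

(* Lebesgue measure on R^n, as the n-fold product of Lebesgue measure on R. *)
Fixpoint lebesgue_cV (n : nat) :
    {sigma_finite_measure set 'cV[R]_n -> \bar R} :=
  if n is n'.+1 then lebesgue_cV_step (lebesgue_cV n')
  else \d_(0 : 'cV[R]_0).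

End lebesgue_measure_cV.

Section multivariate_normal.
Variables (R : realType) (d : nat).

Definition posdefmx (A : 'M[R]_d) : Prop :=
  A^T = A /\ forall x : 'cV[R]_d, x != 0 -> 0 < (x^T *m A *m x) 0 0.

(* B is the symmetric positive definite square root of A. *)
Definition is_sqrtmx (B A : 'M[R]_d) : Prop := posdefmx B /\ B *m B = A.

Definition multinormal_pdf (m : 'cV[R]_d) (C : 'M[R]_d) (x : 'cV[R]_d) : R :=
  (Num.sqrt ((2 * pi) ^+ d * \det C))^-1 *
  expR (- ((x - m)^T *m invmx C *m (x - m)) 0 0 / 2).

(* The law N(m, C), for a positive definite covariance matrix C. *)
Definition multinormal_prob (m : 'cV[R]_d) (C : 'M[R]_d) :
    set 'cV[R]_d -> \bar R :=
  fun A => (\int[@lebesgue_cV R d]_(x in A) (multinormal_pdf m C x)%:E)%E.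

End multivariate_normal.

Section probability.
Context {disp : measure_display} {T : measurableType disp} {R : realType}.
Variable P : probability T R.

(* Only meant for P B != 0. *)
Definition cond_prob (A B : set T) : \bar R := (P (A `&` B) / P B)%E.

Definition independent_RVs {disp1 disp2 : measure_display}
    {T1 : measurableType disp1} {T2 : measurableType disp2}
    (X : T -> T1) (Y : T -> T2) : Prop :=
  forall A B, measurable A -> measurable B ->
    (P (X @^-1` A `&` Y @^-1` B) = P (X @^-1` A) * P (Y @^-1` B))%E.

(* eta is a version of x |-> E[Y | X = x]. *)
Definition is_cond_expectation {disp1 : measure_display}
    {T1 : measurableType disp1} (Y : T -> R) (X : T -> T1) (eta : T1 -> R) :
    Prop :=
  [/\ measurable_fun setT eta,
      P.-integrable setT (fun w => (eta (X w))%:E) &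
      forall B, measurable B ->
        (\int[P]_(w in X @^-1` B) (eta (X w))%:E =
         \int[P]_(w in X @^-1` B) (Y w)%:E)%E].

Definition sq_risk {T1 : Type} (Y : T -> R) (X : T -> T1) (h : T1 -> R) :
    \bar R :=
  'E_P[fun w => ((Y w - h (X w)) ^+ 2)%R]%E.

Definition is_risk_minimizer {T1 : Type} (Y : T -> R) (X : T -> T1)
    (H : set (T1 -> R)) (h : T1 -> R) : Prop :=
  H h /\ forall g, H g -> (sq_risk Y X h <= sq_risk Y X g)%E.

Definition approximation_error {T1 : Type} (X : T -> T1) (eta h : T1 -> R) :
    \bar R :=
  'E_P[fun w => ((eta (X w) - h (X w)) ^+ 2)%R]%E.

End probability.

Definition sigmoid {R : realType} (z : R) : R := 1 / (1 + expR (- z)).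

Definition logistic_class (R : realType) (d : nat) : set ('cV[R]_d -> R) :=
  [set h | exists (a : 'cV[R]_d) (b' : R),
     h = fun x => sigmoid ((a^T *m x) 0 0 + b')].
Arguments logistic_class : clear implicits.

(* Class labels k in {0, 1} are booleans: false stands for 0, true for 1.
   Scalars such as x^T y are entries of 1 x 1 matrices. *)
Section ccg.
Variables (R : realType) (d : nat) (p sigma : R).
Variables (mu : bool -> 'cV[R]_d) (Sigma : bool -> 'M[R]_d).

Let pb : R := 1 - p.
Let mu0 := mu false.
Let mu1 := mu true.
Let Sigma0 := Sigma false.
Let Sigma1 := Sigma true.

Definition tSigma (k : bool) : 'M[R]_d := Sigma k + (sigma ^+ 2)%:M.

Definition mu_diff : 'cV[R]_d := mu1 - mu0.

Definition ccg_A : 'M[R]_d :=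
  2^-1 *: (invmx (tSigma false) - invmx (tSigma true)).

Definition ccg_b : 'cV[R]_d :=
  invmx (tSigma true) *m mu1 - invmx (tSigma false) *m mu0.

Definition ccg_c : R :=
  2^-1 * (mu0^T *m invmx (tSigma false) *m mu0) 0 0
  - 2^-1 * (mu1^T *m invmx (tSigma true) *m mu1) 0 0
  + 2^-1 * ln (\det (tSigma false) / \det (tSigma true))
  + ln (p / pb).

(* Here B k is the square root of tSigma k, and Q k, lambda k give the
   eigenvectors (columns) and eigenvalues of B k *m ccg_A *m B k. *)
Variables (B Q : bool -> 'M[R]_d) (lambda : bool -> 'rV[R]_d).

Definition ccg_u (k : bool) : 'cV[R]_d :=
  (Q k)^T *m B k *m (ccg_b + 2 *: (ccg_A *m mu k)).

Definition ccg_M (k : bool) : R :=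
  \sum_(j < d) lambda k 0 j + (ccg_b^T *m mu k) 0 0
  + ((mu k)^T *m ccg_A *m mu k) 0 0 + ccg_c.

Definition ccg_V (k : bool) : R :=
  \sum_(j < d) (2 * lambda k 0 j ^+ 2 + ccg_u k j 0 ^+ 2).

Definition ccg_VAR1 : R :=
  p * ccg_V true + pb * ccg_V false
  + p * pb * (ccg_M true - ccg_M false) ^+ 2.

Definition ccg_COV : 'rV[R]_d :=
  (2 * p) *: (mu1^T *m ccg_A *m Sigma1)
  + (2 * pb) *: (mu0^T *m ccg_A *m Sigma0)
  + (2 * sigma ^+ 2) *: ((p *: mu1 + pb *: mu0)^T *m ccg_A)
  + (p * pb * (\tr (ccg_A *m (Sigma1 - Sigma0))
               + (mu1^T *m ccg_A *m mu1) 0 0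
               - (mu0^T *m ccg_A *m mu0) 0 0)) *: mu_diff^T
  + ccg_b^T *m (p *: Sigma1 + pb *: Sigma0 + (sigma ^+ 2)%:M
                + (p * pb) *: (mu_diff *m mu_diff^T)).

Definition ccg_VAR2 : 'M[R]_d :=
  p *: Sigma1 + pb *: Sigma0 + (p * pb) *: (mu_diff *m mu_diff^T)
  + (sigma ^+ 2)%:M.

Definition epsilon_CCG : R :=
  4^-1 * (ccg_VAR1 - (ccg_COV *m invmx ccg_VAR2 *m ccg_COV^T) 0 0).

End ccg.

(* Main.v *)
From HB Require Import structures.
Require Import Defs.
From mathcomp Require Import all_boot all_order all_algebra.
From mathcomp Require Import all_classical all_reals all_analysis.
From mathcomp Require Import measurable_realfun ring lra.

(** The posterior probability of the label given [Xsigma = x] is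
[sigmoid (q x)], where the log odds [q] is a quadratic polynomial, because the
two conditional laws of [Xsigma] are normal.  The excess risk of any [h] over
the conditional mean is the mean square distance between the two, so [hstar]
may be replaced by any logistic function; take [sigmoid (a^T x + b')] with
[a^T x + b'] the least-squares affine approximation of [q].  As the sigmoid is
1/2-Lipschitz (the sharp constant 1/4 is not needed), the error is at most a quarter of
[E (q - a^T x - b')^2], and this is the residual variance
[VAR1 - COV VAR2^-1 COV^T].

The normal conditional laws come from completing the square in the convolution
integral.  Triangular changes of variables follow from Tonelli's theorem and the
recursive definition of Lebesgue measure; the Cholesky decomposition reduces
normal laws to standard ones, where the second moment of a quadratic polynomial
is computed by induction on the dimension. *)

Set Implicit Arguments.
Unset Strict Implicit.
Unset Printing Implicit Defensive.

Import Order.TTheory GRing.Theory Num.Theory.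
Import numFieldNormedType.Exports.

Local Open Scope classical_set_scope.
Local Open Scope ring_scope.

(** * Integration preliminaries *)

(** The bound is the residual variance of a linear regression. Under [N(mu k, tSigma k)] the log
    odds [q] has mean [M_k] and variance [V_k]; by the laws of total variance and covariance over
    the two classes, [VAR1] is the variance of [q(Xsigma)], [COV] its covariance with [Xsigma], and
    [VAR2] the covariance matrix of [Xsigma]. The eigenvalues and eigenvectors enter only through
    traces and norms, which do not depend on how they are chosen.

    Wherever possible the integrands are nonnegative, so that Tonelli and monotone convergence apply
    without integrability side conditions. This is why the square of a quadratic polynomial is
    integrated as a whole instead of being expanded into signed moments.

    The given [eta] is only some version of the conditional expectation. It is first identified,
    almost everywhere for the law of [Xsigma], with the explicit posterior; from then on all
    computations use the latter. *)

Section density.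
Local Open Scope ereal_scope.
Context d (T : measurableType d) (R : realType).
Variables (nu mu : {measure set T -> \bar R}) (f : T -> R).
Hypothesis f0 : forall x, (0 <= f x)%R.
Hypothesis mf : measurable_fun setT f.
Hypothesis nuE : forall A, measurable A -> nu A = \int[mu]_(x in A) (f x)%:E.
Import HBNNSimple.

(** The density is known only through the values of [nu] on measurable sets, which is the form in
    which [multinormal_prob] describes a normal law. For simple functions the claim is [nuE];
    monotone convergence does the rest. *)
Lemma ge0_integral_density (F : T -> \bar R) :
  (forall x, 0 <= F x) -> measurable_fun setT F ->
  \int[nu]_x F x = \int[mu]_x (F x * (f x)%:E).
Proof.
move=> F0 mF; pose h := nnsfun_approx measurableT mF.
have hF x : (h n x)%:E @[n --> \oo] --> F x by exact: cvg_nnsfun_approx.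
transitivity (limn (fun n => \int[nu]_x (h n x)%:E)).
  rewrite -monotone_convergence//.
  - by apply: eq_integral => x _; apply/esym/cvg_lim => //; exact: hF.
  - by move=> n; exact/measurable_EFinP/measurable_funP.
  - by move=> n y _; rewrite lee_fin.
  - by move=> y _ m n mn; rewrite lee_fin; exact/lefP/nd_nnsfun_approx.
transitivity (limn (fun n => \int[mu]_x ((h n x)%:E * (f x)%:E))); last first.
  rewrite -monotone_convergence//.
  - apply: eq_integral => x _; apply/cvg_lim => //.
    exact: cvgeZr.
  - by move=> n; apply/measurable_EFinP/measurable_funM.
  - by move=> n x _; rewrite -EFinM lee_fin mulr_ge0.
  - move=> x _ m n mn; rewrite lee_wpmul2r// lee_fin//.
    exact/lefP/nd_nnsfun_approx.
congr (limn _); apply/funext => n.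
under eq_integral do rewrite fimfunE -fsumEFin//.
rewrite ge0_integral_fsum//; last 2 first.
- by move=> y; exact/measurable_EFinP/measurable_funM.
- by move=> y x _; rewrite nnfun_muleindic_ge0.
have mfn r : measurable (h n @^-1` [set r]) by exact: measurable_funPTI.
transitivity (\sum_(r \in range (h n))
    \int[mu]_x ((r * \1_(h n @^-1` [set r]) x)%:E * (f x)%:E)); last first.
  rewrite -ge0_integral_fsum//.
  - apply: eq_integral => x _; rewrite [in RHS]fimfunE -fsumEFin//.
    rewrite ge0_mule_fsuml// => r; exact: nnfun_muleindic_ge0.
  - by move=> r; apply/measurable_EFinP/measurable_funM => //; exact: measurable_funM.
  - move=> r x _; apply: mule_ge0; last by rewrite lee_fin.
    by rewrite EFinM nnfun_muleindic_ge0.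
apply: eq_fsbigr => r _.
rewrite integralZl_indic_nnsfun// integral_indic// setIT nuE//.
have [r0|r0] := leP 0%R r; last first.
  rewrite preimage_nnfun0// integral_set0 mule0 integral0_eq// => x _.
  by rewrite indic0 mulr0 mul0e.
under [RHS]eq_integral do rewrite EFinM -muleA.
rewrite ge0_integralZl_EFin//; last 2 first.
  by move=> x _; rewrite mule_ge0// lee_fin.
  by apply/measurable_EFinP/measurable_funM.
congr (_ * _); rewrite integral_mkcond; apply: eq_integral => x _.
by rewrite patchE indicE; case: ifPn => _; rewrite ?mul1e ?mul0e.
Qed.

End density.

Section lebesgue_affine.
Local Open Scope ereal_scope.
Context {R : realType}.
Local Notation mu := (@lebesgue_measure R).

(** The image of [a] times Lebesgue measure under [a * x + m] gives each half-open interval its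
    length, so it is Lebesgue measure. Hence [F] may be any nonnegative measurable function, with no
    continuity. *)
Lemma ge0_integral_affine (a m : R) (F : R -> \bar R) : (0 < a)%R ->
  measurable_fun setT F -> (forall x, 0 <= F x) ->
  \int[mu]_x F x = a%:E * \int[mu]_x F (a * x + m)%R.
Proof.
move=> a0 mF F0.
pose phi (x : measurableTypeR R) : measurableTypeR R := (a * x + m)%R.
have mphi : measurable_fun setT phi.
  by apply: measurable_funD => //; exact: measurable_funM.
rewrite -[RHS]ge0_integralZl_EFin ?(ltW a0)//; last first.
  exact: (measurableT_comp mF mphi).
have a0' : (0 <= a)%R by exact: ltW.
rewrite [RHS](_ : _ = \int[mscale (NngNum a0') mu]_x (F \o phi) x); last first.
  rewrite ge0_integral_mscale//=; last exact: (measurableT_comp mF mphi).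
  by rewrite ge0_integralZl_EFin//; exact: (measurableT_comp mF mphi).
have := @ge0_integral_pushforward _ _ _ _ _ _ mphi (mscale (NngNum a0') mu)
  setT F measurableT mF (fun x _ => F0 x).
rewrite preimage_setT => <-.
apply: eq_measure_integral => //= A mA _.
apply: (@lebesgue_measure_unique _ (pushforward (mscale (NngNum a0') mu) phi)) => // _ [[u v]] _ <-.
have phiE : phi @^-1` `]u, v] = `]((u - m) / a)%R, ((v - m) / a)%R]%classic.
  apply/seteqP; split => x /=; rewrite /phi !in_itv/=.
    by rewrite ltr_pdivrMr// ler_pdivlMr// ltrBlDr lerBrDr mulrC.
  by rewrite ltr_pdivrMr// ler_pdivlMr// ltrBlDr lerBrDr mulrC.
rewrite lebesgue_measure_itv.
transitivity (mscale (NngNum a0') mu `]((u - m) / a)%R, ((v - m) / a)%R]); last first.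
  by congr (mscale _ _ _); exact/esym/phiE.
rewrite /mscale/= lebesgue_measure_itv/=.
rewrite !lte_fin ltr_pM2r ?invr_gt0// ltrD2r.
case: ifP => _; last by rewrite mule0.
rewrite -!EFinB -EFinM; congr (_%:E); field; exact: lt0r_neq0.
Qed.

End lebesgue_affine.

(** * Moments of the one-dimensional normal distribution *)

Section gauss_moments.
Context {R : realType}.
Local Notation mu := (@lebesgue_measure R).
Local Open Scope ereal_scope.

Let g (t : R) : R := expR (- t ^+ 2 / 2).

Let is_derive_g (t : R) : is_derive t 1%R g (- (t * g t))%R.
Proof.
rewrite /g; apply: is_derive_eq.
by rewrite /GRing.scale/=; field.
Qed.

Let continuous_g : continuous g.
Proof.
by move=> t; apply: differentiable_continuous; apply/derivable1_diffP; case: (is_derive_g t).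
Qed.

Let integral_tail (u : R) : (0 <= u)%R ->
  \int[mu]_(t in `[u, +oo[) (t * g t)%:E = (g u)%:E.
Proof.
move=> u0.
have dF (t : R) : is_derive t 1%R (fun t => - g t)%R (t * g t)%R.
  by have dg := is_derive_g t; apply: is_derive_eq; rewrite opprK.
have cF : continuous (fun t => - g t)%R by move=> t; apply: cvgN; exact: continuous_g.
rewrite (@ge0_continuous_FTC2y _ _ (fun t => - g t)%R u 0%R).
- by rewrite sub0e -EFinN opprK.
- by move=> t ut; rewrite mulr_ge0 ?expR_ge0// (le_trans u0).
- apply: continuous_subspaceT => t; apply: cvgM; [exact: cvg_id|exact: continuous_g].
- rewrite -oppr0; apply: cvgN.
  rewrite (_ : g = fun t => expR (- (t ^+ 2 / 2))%R); last first.
    by apply/funext => t; rewrite /g mulNr.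
  apply: (cvg_comp (fun t : R => t ^+ 2 / 2)%R (fun x => expR (- x))).
    by apply: gt0_cvgMly; [lra|exact: cvgr_expr2].
  exact: cvgr_expR.
- by move=> t ut; case: (dF t).
- exact/cvg_at_right_filter/cF.
- by move=> t _; rewrite derive1E; apply: derive_val.
Qed.

Let integral_pow k (t : R) : (0 <= t)%R ->
  \int[mu]_(u in `[0%R, t]) (u ^+ k)%:E = (t ^+ k.+1 / k.+1%:R)%:E.
Proof.
rewrite le_eqVlt => /predU1P[<-|t0].
  by rewrite set_itv1 integral_set1 expr0n/= mul0r.
have dF (u : R) : is_derive u 1%R (fun u => u ^+ k.+1 / k.+1%:R)%R (u ^+ k)%R.
  rewrite (_ : (fun u => _) = k.+1%:R^-1 \*: (@id R ^+ k.+1))%R; last first.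
    by apply/funext => v; rewrite [RHS]/GRing.scale/= exprfctE mulrC.
  apply: is_derive_eq; rewrite /GRing.scale/= mulr1.
  by rewrite mulrA mulVf ?mul1r// pnatr_eq0.
have cF : continuous (fun u : R => u ^+ k.+1 / k.+1%:R)%R.
  by move=> u; apply: differentiable_continuous; apply/derivable1_diffP; case: (dF u).
rewrite (@continuous_FTC2 _ _ (fun u => u ^+ k.+1 / k.+1%:R)%R _ _ t0).
- by rewrite expr0n/= mul0r sube0.
- by apply: continuous_subspaceT => u; exact: exprn_continuous.
- split => [u _||]; first by case: (dF u).
  + exact/cvg_at_right_filter/cF.
  + exact/cvg_at_left_filter/cF.
- by move=> u _; rewrite derive1E; apply: derive_val.
Qed.

Let J k := \int[mu]_(t in `[0%R, +oo[) (t ^+ k * g t)%:E.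

Let measurable_pow_g k : measurable_fun setT (fun t : R => t ^+ k * g t)%R.
Proof.
by apply: measurable_funM => //; exact: continuous_measurable_fun continuous_g.
Qed.

(* Tonelli on the region [0 <= u <= t] for [u ^ k * (t * g t)], using that
   [- g] is a primitive of [t * g t]. *)
Let JS k : J k.+2 = k.+1%:R%:E * J k.
Proof.
pose D := [set z : measurableTypeR R * measurableTypeR R | (0 <= z.1) && (z.1 <= z.2)]%R.
have mD : measurable D.
  have mb : measurable_fun setT
      (fun z : measurableTypeR R * measurableTypeR R => (0 <= z.1) && (z.1 <= z.2))%R.
    apply: measurable_and.
      by apply: measurable_fun_ler => //; exact: measurable_fst.
    by apply: measurable_fun_ler; [exact: measurable_fst|exact: measurable_snd].
  by rewrite -[D]setTI; exact: (mb measurableT [set true]).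
pose h (z : measurableTypeR R * measurableTypeR R) : \bar R :=
  ((z.1 ^+ k * (z.2 * g z.2)) * \1_D z)%:E.
have mh : measurable_fun setT h.
  apply/measurable_EFinP/measurable_funM => //; apply: measurable_funM.
    by apply: (measurableT_comp (exprn_measurable _)); exact: measurable_fst.
  have mg := measurable_pow_g 1.
  under eq_fun do rewrite -[X in (X * _)%R]expr1.
  by apply: (measurableT_comp mg); exact: measurable_snd.
have hE u t : h (u, t) =
    if (0 <= u <= t)%R then (u ^+ k * (t * g t))%:E else 0.
  rewrite /h /= indicE (_ : (_ \in D) = (0 <= u <= t)%R).
    by case: ifP; rewrite ?mulr1 ?mulr0.
  by apply/idP/idP => [/set_mem|? ]//; exact/mem_set.
have h0 z : 0 <= h z.
  case: z => u t; rewrite hE; case: ifPn => // /andP[u0 ut].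
  by rewrite lee_fin mulr_ge0 ?exprn_ge0// mulr_ge0 ?expR_ge0// (le_trans u0).
have uD u t : (0 <= u)%R ->
    h (u, t) = if (t \in `[u, +oo[) then (u ^+ k)%:E * (t * g t)%:E else 0.
  by move=> u0; rewrite hE in_itv/= andbT u0 EFinM.
have tD u t :
    h (u, t) = if (u \in `[0%R, t]) then (t * g t)%:E * (u ^+ k)%:E else 0.
  by rewrite hE in_itv/= mulrC EFinM.
have := @fubini_tonelli _ _ _ _ R mu mu h mh h0.
rewrite (_ : \int[mu]_x _ = J k); last first.
  rewrite /J [RHS]integral_mkcond; apply: eq_integral => u _.
  rewrite patchE mem_setE in_itv/= andbT; case: leP => u0.
    under eq_integral do rewrite uD//.
    rewrite (_ : \int[mu]_y _ = \int[mu]_(t in `[u, +oo[) ((u ^+ k)%:E * (t * g t)%:E)); last first.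
      by rewrite [RHS]integral_mkcond; apply: eq_integral => t _; rewrite patchE mem_setE.
    rewrite ge0_integralZl_EFin ?exprn_ge0//.
    - by rewrite integral_tail// EFinM.
    - move=> t /=; rewrite in_itv/= andbT => ut; rewrite lee_fin mulr_ge0 ?expR_ge0//.
      exact: le_trans ut.
    - apply: measurable_funTS; apply/measurable_EFinP.
      by have := measurable_pow_g 1; under eq_fun do rewrite expr1.
  rewrite integral0_eq// => t _; rewrite tD in_itv/=.
  by rewrite leNgt u0.
move=> ->.
rewrite (_ : \int[mu]_y _ = (k.+1%:R^-1)%:E * J k.+2); last first.
  rewrite /J -ge0_integralZl_EFin ?invr_ge0//; last 2 first.
  - move=> t /=; rewrite in_itv/= andbT => t0.
    by rewrite lee_fin mulr_ge0 ?expR_ge0// exprn_ge0.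
  - by apply: measurable_funTS; apply/measurable_EFinP; exact: measurable_pow_g.
  rewrite [RHS]integral_mkcond; apply: eq_integral => t _.
  rewrite patchE mem_setE in_itv/= andbT; case: leP => t0.
    under eq_integral do rewrite tD.
    rewrite (_ : \int[mu]_x _ = \int[mu]_(u in `[0%R, t]) ((t * g t)%:E * (u ^+ k)%:E)); last first.
      by rewrite [RHS]integral_mkcond; apply: eq_integral => u _; rewrite patchE mem_setE.
    rewrite ge0_integralZl_EFin ?mulr_ge0 ?expR_ge0//.
    - rewrite integral_pow// -!EFinM; congr EFin; rewrite [in RHS]exprS; ring.
    - by move=> u /=; rewrite in_itv/= => /andP[u0 _]; rewrite lee_fin exprn_ge0.
    - by apply/measurable_funTS/measurable_EFinP.
  rewrite integral0_eq// => u _; rewrite tD in_itv/=; case: ifP => // /andP[u0].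
  by move=> /(le_trans u0); rewrite leNgt t0.
by rewrite muleA -EFinM divff ?mul1e// pnatr_eq0.
Qed.

Let integral_g : \int[mu]_t (g t)%:E = (Num.sqrt (2 * pi))%:E.
Proof.
have K0 : (0 < Num.sqrt (2 * pi) :> R)%R by rewrite sqrtr_gt0 mulr_gt0// pi_gt0.
have := integral_normal_pdf (0 : R) 1%R.
under eq_integral.
  move=> t _; rewrite normal_pdfE ?oner_neq0// /normal_peak /normal_fun.
  rewrite subr0 expr1n mul1r -[(pi *+ 2)%R]mulr_natl EFinM; over.
rewrite /= ge0_integralZl_EFin ?invr_ge0 ?sqrtr_ge0//; last first.
  apply/measurable_EFinP; apply: continuous_measurable_fun; exact: continuous_g.
move=> /(congr1 (fun x => (Num.sqrt (2 * pi))%:E * x)).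
by rewrite mule1 muleA -EFinM divff ?mul1e// gt_eqF.
Qed.

Let J0 : J 0 = (Num.sqrt (2 * pi) / 2)%:E.
Proof.
have gN : g =1 g \o -%R by move=> t; rewrite /g /= sqrrN.
have := ge0_symfun_integralT (fun t => expR_ge0 (- t ^+ 2 / 2)) continuous_g gN.
rewrite integral_g /J set_itvcy.
under [in X in _ -> X]eq_integral do rewrite expr0 mul1r.
move=> /(congr1 (fun x => (2^-1)%:E * x)).
by rewrite muleA -!EFinM mulVf// mul1e mulrC => <-.
Qed.

(** The moments of orders 0 to 4 of the standard normal law are 1, 0, 1, 0, 3. Nonnegativity of [p]
    allows the line to be folded at 0: in [f t + f (- t)] the odd terms cancel pointwise, and only
    the even half-line moments [J 0], [J 2], [J 4] remain. *)
Lemma integral_normal_quartic (p0 p1 p2 p3 p4 : R) :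
  let p t := (p0 + p1 * t + p2 * t ^+ 2 + p3 * t ^+ 3 + p4 * t ^+ 4)%R in
  (forall t, 0 <= p t)%R ->
  \int[mu]_t (p t * ((Num.sqrt (2 * pi))^-1 * expR (- t ^+ 2 / 2)))%:E =
  (p0 + p2 + 3 * p4)%:E.
Proof.
move=> p p_ge0; set K := Num.sqrt (2 * pi).
have K0 : (0 < K)%R by rewrite sqrtr_gt0 mulr_gt0// pi_gt0.
pose f t := (p t * (K^-1 * g t))%R.
have mf : measurable_fun setT (fun t : R => (f t)%:E).
  apply/measurable_EFinP/measurable_funM.
    have mX k (c : R) : measurable_fun setT (fun t : R => c * t ^+ k)%R.
      by apply: measurable_funM => //; exact: exprn_measurable.
    by do 4 apply: measurable_funD => //; exact: (mX 1%N).
  by apply: measurable_funM => //; exact: continuous_measurable_fun continuous_g.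
have f0 t : 0 <= (f t)%:E.
  by rewrite lee_fin /f mulr_ge0// mulr_ge0 ?invr_ge0 ?sqrtr_ge0// expR_ge0.
rewrite -[LHS]/(\int[mu]_t (f t)%:E).
have -> : \int[mu]_t (f t)%:E = \int[mu]_(t in `[0%R, +oo[) ((f t)%:E + (f (- t)%R)%:E).
  rewrite -(setUv `[0%R, +oo[%classic) ge0_integral_setU//=; last 3 first.
  - exact: measurableC.
  - by rewrite setUv.
  - exact/disj_setPCl.
  rewrite ge0_integralD//; last 2 first.
  - exact: measurable_funTS.
  - by apply: measurable_funTS; exact: (measurableT_comp mf (@oppr_measurable _ setT)).
  congr (_ + _); rewrite setCitvr/=.
  rewrite integral_itv_bndo_bndc; last exact: measurable_funTS.
  rewrite (@ge0_integration_by_substitution0 _ (fun t => (f (- t)%R)%:E))//.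
    by apply: eq_integral => t _; rewrite opprK.
  exact: (measurableT_comp mf (@oppr_measurable _ setT)).
have EJ k : mu.-integrable `[0%R, +oo[ (fun t => (t ^+ k.*2 * g t)%:E).
  apply/integrableP; split.
    by apply: measurable_funTS; apply/measurable_EFinP; exact: measurable_pow_g.
  under eq_integral do rewrite gee0_abs ?lee_fin ?mulr_ge0 ?expR_ge0 ?exprn_even_ge0 ?odd_double//.
  elim: k => [|k IH]; first by rewrite -/(J 0) J0 ltry.
  rewrite -/(J k.+1.*2) doubleS JS; exact: lte_mul_pinfty.
transitivity (\int[mu]_(t in `[0%R, +oo[) (
   (2 * p0 / K)%:E * (t ^+ 0 * g t)%:E
   + (2 * p2 / K)%:E * (t ^+ 2 * g t)%:E
   + (2 * p4 / K)%:E * (t ^+ 4 * g t)%:E)).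
  apply: eq_integral => t _; rewrite -!EFinM -!EFinD; congr EFin.
  rewrite /f /p {2}/g sqrrN -/(g t); field; exact: lt0r_neq0.
have mI : measurable (`[0%R, +oo[%classic : set (measurableTypeR R)) by [].
have EJZ k (c : R) := integrableZl mI c (EJ k).
rewrite integralD//=.
- rewrite integralD//=; [|exact: (EJZ 0%N)|exact: (EJZ 1%N)].
  rewrite (integralZl mI (EJ 0%N)) (integralZl mI (EJ 1%N)) (integralZl mI (EJ 2%N)).
  rewrite -/(J 0) -/(J 2) -/(J 4) !JS J0 -!EFinM -!EFinD; congr EFin.
  rewrite -/K; field; exact: lt0r_neq0.
- by apply: integrableD => //; [exact: (EJZ 0%N)|exact: (EJZ 1%N)].
- exact: (EJZ 2%N).
Qed.

End gauss_moments.

(** * Lebesgue measure on column vectors *)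

Section measurable_matrix_operations.
Context {R : realType} {disp : measure_display} {U : measurableType disp}.

Lemma measurable_fun_entry m n (f : U -> 'M[R]_(m, n)) i j :
  measurable_fun setT f -> measurable_fun setT (fun x => f x i j).
Proof. by move/measurable_fun_matrixP. Qed.

Lemma measurable_mulmx m n q (f : U -> 'M[R]_(m, n)) (g : U -> 'M[R]_(n, q)) :
  measurable_fun setT f -> measurable_fun setT g ->
  measurable_fun setT (fun x => f x *m g x).
Proof.
move=> /measurable_fun_matrixP mf /measurable_fun_matrixP mg.
apply/measurable_fun_matrixP => i j; under eq_fun do rewrite mxE.
by apply: measurable_sum => k; exact: measurable_funM.
Qed.

Lemma measurable_addmx m n (f g : U -> 'M[R]_(m, n)) :
  measurable_fun setT f -> measurable_fun setT g ->
  measurable_fun setT (fun x => f x + g x).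
Proof.
move=> /measurable_fun_matrixP mf /measurable_fun_matrixP mg.
apply/measurable_fun_matrixP => i j; under eq_fun do rewrite mxE.
exact: measurable_funD.
Qed.

Lemma measurable_oppmx m n (f : U -> 'M[R]_(m, n)) :
  measurable_fun setT f -> measurable_fun setT (fun x => - f x).
Proof.
move=> /measurable_fun_matrixP mf.
apply/measurable_fun_matrixP => i j; under eq_fun do rewrite mxE.
exact: measurableT_comp.
Qed.

Lemma measurable_trmx m n (f : U -> 'M[R]_(m, n)) :
  measurable_fun setT f -> measurable_fun setT (fun x => (f x)^T).
Proof.
move=> /measurable_fun_matrixP mf.
apply/measurable_fun_matrixP => i j; under eq_fun do rewrite mxE.
exact: mf.
Qed.

Lemma measurable_scalemx m n (f : U -> R) (g : U -> 'M[R]_(m, n)) :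
  measurable_fun setT f -> measurable_fun setT g ->
  measurable_fun setT (fun x => f x *: g x).
Proof.
move=> mf /measurable_fun_matrixP mg.
apply/measurable_fun_matrixP => i j; under eq_fun do rewrite mxE.
exact: measurable_funM.
Qed.

Lemma measurable_affine_mx m n q (A : 'M[R]_(m, n)) (b : 'M[R]_(m, q)) (f : U -> 'M[R]_(n, q)) :
  measurable_fun setT f -> measurable_fun setT (fun x => A *m f x + b).
Proof.
move=> mf; apply: measurable_addmx; last exact: measurable_cst.
by apply: measurable_mulmx => //; exact: measurable_cst.
Qed.

Lemma measurable_quadratic n (A : 'M[R]_n) (w : 'rV[R]_n) (c : R) (f : U -> 'cV[R]_n) :
  measurable_fun setT f ->
  measurable_fun setT (fun x => ((f x)^T *m A *m f x) 0 0 + (w *m f x) 0 0 + c).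
Proof.
move=> mf; apply: measurable_funD => //; apply: measurable_funD; apply: measurable_fun_entry.
  apply: measurable_mulmx => //; apply: measurable_mulmx => //.
  exact: measurable_trmx.
exact: measurable_mulmx.
Qed.

End measurable_matrix_operations.

Lemma cV_consD (R : realType) n (t s : R) (v w : 'cV[R]_n) :
  cV_cons (t, v) + cV_cons (s, w) = cV_cons (t + s, v + w).
Proof. by rewrite /cV_cons/= [LHS](@add_col_mx R 1 n 1) -raddfD. Qed.

(** Peels off the first coordinate in the way the recursion of [lebesgue_cV] needs: the first
    coordinate of the image depends on [t] alone, and for fixed [t] the others are a triangular
    affine function of [v]. *)
Lemma trig_mx_cV_cons (R : realType) n (L : 'M[R]_n.+1) :
  is_trig_mx L -> (forall i, 0 < L i i) ->
  exists (a : R) (r : 'cV[R]_n) (L' : 'M[R]_n),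
  [/\ 0 < a, is_trig_mx L', (forall i, 0 < L' i i), \det L = a * \det L' &
   forall t v, L *m cV_cons (t, v) = cV_cons (a * t, t *: r + L' *m v)].
Proof.
move=> tL L0; exists (L 0 0), (@dlsubmx R 1 n 1 n L), (@drsubmx R 1 n 1 n L).
have LE : L = block_mx (L 0 0)%:M 0 (@dlsubmx R 1 n 1 n L) (@drsubmx R 1 n 1 n L).
  rewrite -[LHS](@submxK R 1 n 1 n); congr (@block_mx R 1 n 1 n _ _ _ _).
    apply/matrixP => i j; rewrite !ord1 !mxE eqxx mulr1n; congr (L _ _); exact/val_inj.
  apply/matrixP => i j; rewrite !mxE; apply: (is_trig_mxP tL).
  by rewrite ord1.
split => //.
- by apply/is_trig_mxP => i j ij; rewrite !mxE; apply: (is_trig_mxP tL); rewrite /= ltn_add2l.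
- by move=> i; rewrite !mxE.
- by rewrite {1}LE (@det_lblock _ 1 n) det_scalar1.
- move=> t v; rewrite /cV_cons/= {1}LE (@mul_block_col _ 1 n 1 n).
  by rewrite mul0mx addr0 -scalar_mxM mul_mx_scalar.
Qed.

Section lebesgue_cV_integral.
Context {R : realType}.
Local Notation mu := (@lebesgue_measure R).
Local Open Scope ereal_scope.

Lemma ge0_integral_lebesgue_cV0 (F : 'cV[R]_0 -> \bar R) :
  measurable_fun setT F ->
  \int[lebesgue_cV R 0]_x F x = F 0%R.
Proof. by move=> mF; rewrite /= integral_dirac// diracT mul1e. Qed.

Lemma ge0_integral_lebesgue_cVS n (F : 'cV[R]_n.+1 -> \bar R) :
  measurable_fun setT F -> (forall x, 0 <= F x) ->
  \int[lebesgue_cV R n.+1]_x F x =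
  \int[mu]_t \int[lebesgue_cV R n]_v F (cV_cons (t, v)).
Proof.
move=> mF F0; have mc := @measurable_cV_cons R n.
have mFc : measurable_fun setT (F \o @cV_cons R n) by exact: measurableT_comp mF mc.
have F0c z : 0 <= (F \o @cV_cons R n) z by exact: F0.
rewrite -(@fubini_tonelli1 _ _ _ _ _ mu (lebesgue_cV R n) _ mFc F0c).
have := @ge0_integral_pushforward _ _ _ _ R (@cV_cons R n) mc
  (mu \x lebesgue_cV R n) setT F measurableT mF (fun x _ => F0 x).
by rewrite preimage_setT => <-.
Qed.

Lemma measurable_fun_lebesgue_cV_section n (F : 'cV[R]_n.+1 -> \bar R) :
  measurable_fun setT F -> (forall x, 0 <= F x) ->
  measurable_fun setT (fun t : measurableTypeR R => \int[lebesgue_cV R n]_v F (cV_cons (t, v))).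
Proof.
move=> mF F0.
have mFc : measurable_fun setT (F \o @cV_cons R n).
  exact: measurableT_comp mF (@measurable_cV_cons R n).
have F0c z : 0 <= (F \o @cV_cons R n) z by exact: F0.
exact: (@measurable_fun_fubini_tonelli_F _ _ _ _ _ (lebesgue_cV R n) _ mFc F0c).
Qed.

(** The induction must be uniform in the shift: once the first coordinate [t] is fixed, the map on
    the remaining ones has shift [t *: r + m']. Each step contributes one diagonal entry to the
    determinant. *)
Lemma ge0_integral_trig n (L : 'M[R]_n) (m : 'cV[R]_n) (F : 'cV[R]_n -> \bar R) :
  is_trig_mx L -> (forall i, (0 < L i i)%R) ->
  measurable_fun setT F -> (forall x, 0 <= F x) ->
  \int[lebesgue_cV R n]_x F x =
  (\det L)%:E * \int[lebesgue_cV R n]_x F (L *m x + m)%R.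
Proof.
elim: n L m F => [|n IH] L m F tL L0 mF F0.
  rewrite !ge0_integral_lebesgue_cV0//; last first.
    exact: (measurableT_comp mF (measurable_affine_mx _ _ (@measurable_id _ _ setT))).
  by rewrite det_mx00 mul1e; congr F; apply/colP => -[].
have mFL : measurable_fun setT (fun x => F (L *m x + m)%R).
  exact: (measurableT_comp mF (measurable_affine_mx _ _ (@measurable_id _ _ setT))).
rewrite !ge0_integral_lebesgue_cVS//.
have [a [r [L' [a0 tL' L'0 detE LcE]]]] := trig_mx_cV_cons tL L0.
have [m0 [m' mE]] : exists m0 m', m = cV_cons (m0, m').
  by exists (cV_uncons m).1, (cV_uncons m).2; rewrite -surjective_pairing cV_unconsK.
have consE t v : (L *m cV_cons (t, v) + m)%R = cV_cons (a * t + m0, L' *m v + (t *: r + m'))%R.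
  by rewrite LcE mE cV_consD addrA (addrC (t *: r)%R).
rewrite (@ge0_integral_affine R a m0); last 3 first.
- exact: a0.
- exact: measurable_fun_lebesgue_cV_section.
- by move=> t; apply: integral_ge0.
have d0 : (0 <= \det L')%R.
  by rewrite det_trig//; apply: prodr_ge0 => i _; exact: ltW.
rewrite detE EFinM -muleA; congr (_ * _).
rewrite -ge0_integralZl_EFin//; last 2 first.
- by move=> t _; exact: integral_ge0.
- exact: (measurable_fun_lebesgue_cV_section mFL (fun x => F0 _)).
apply: eq_integral => t _.
rewrite (IH L' (t *: r + m')%R)//; last first.
  by apply: (measurableT_comp mF); apply: (measurableT_comp (@measurable_cV_cons R n)).
by congr (_ * _); apply: eq_integral => v _; rewrite consE.
Qed.

End lebesgue_cV_integral.

(** * Cholesky decomposition *)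

Section cV_cons_products.
Variable R : realType.
Implicit Types (t s : R).

Lemma cV_cons_mul n t s (v w : 'cV[R]_n) :
  (cV_cons (t, v))^T *m cV_cons (s, w) = (t * s)%:M + v^T *m w.
Proof.
rewrite /cV_cons/= (@tr_col_mx _ 1 n) (@mul_row_col _ 1 1 n).
by rewrite tr_scalar_mx -scalar_mxM.
Qed.

(** The symmetric counterpart of the triangular peeling, used both for Cholesky and for integrating
    out all coordinates but the first from a quadratic polynomial. *)
Lemma symmx_cV_cons n (G : 'M[R]_n.+1) : G^T = G ->
  exists (g : R) (r : 'cV[R]_n) (G' : 'M[R]_n),
  [/\ G = block_mx g%:M r^T r G', G'^T = G', \tr G = g + \tr G',
    \tr (G *m G) = g ^+ 2 + 2 * (r^T *m r) 0 0 + \tr (G' *m G') &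
   forall t v, G *m cV_cons (t, v) =
     cV_cons (g * t + (r^T *m v) 0 0, t *: r + G' *m v)].
Proof.
move=> Gs; pose r := @dlsubmx R 1 n 1 n G; pose G' := @drsubmx R 1 n 1 n G.
exists (G 0 0), r, G'.
have GE : G = block_mx (G 0 0)%:M r^T r G'.
  rewrite -[LHS](@submxK R 1 n 1 n); congr (@block_mx R 1 n 1 n _ _ _ _).
    apply/matrixP => i j; rewrite !ord1 !mxE eqxx mulr1n; congr (G _ _); exact/val_inj.
  apply/matrixP => i j; rewrite !mxE -{1}Gs mxE; congr (G _ _); exact/val_inj.
split => //.
- by apply/matrixP => i j; rewrite !mxE -[in RHS]Gs mxE.
- by rewrite {1}GE (@mxtrace_block _ 1 n) mxtrace_scalar.
- rewrite {1 2}GE (@mulmx_block _ 1 n 1 n 1 n) (@mxtrace_block _ 1 n) !mxtraceD.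
  rewrite -scalar_mxM mxtrace_scalar [\tr (r *m _)]mxtrace_mulC /mxtrace.
  rewrite !big_ord1 !mulr1n; ring.
- move=> t v; rewrite /cV_cons/= {1}GE [LHS](@mul_block_col _ 1 n 1 n).
  rewrite -scalar_mxM mul_mx_scalar raddfD/=; congr (@col_mx _ 1 n _ _ _).
  by congr (_ + _); exact: mx11_scalar.
Qed.

(** The matrix [C' - c^-1 *: (r *m r^T)] is the Schur complement of the corner entry. *)
Lemma posdefmx_cV_cons n (C : 'M[R]_n.+1) : posdefmx C ->
  exists (c : R) (r : 'cV[R]_n) (C' : 'M[R]_n),
  [/\ 0 < c, posdefmx (C' - c^-1 *: (r *m r^T)) &
   C = block_mx c%:M r^T r C'].
Proof.
move=> [Cs Cp]; have [c [r [C' [CE C's _ _ CcE]]]] := symmx_cV_cons Cs.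
have quad t v : ((cV_cons (t, v))^T *m C *m cV_cons (t, v)) 0 0 =
    c * t ^+ 2 + 2 * t * (r^T *m v) 0 0 + (v^T *m C' *m v) 0 0.
  rewrite -mulmxA CcE cV_cons_mul mulmxDr -scalemxAr mulmxA !mxE eqxx mulr1n.
  have -> : \sum_j v^T 0 j * r j 0 = \sum_j r^T 0 j * v j 0.
    by apply: eq_bigr => k _; rewrite !mxE mulrC.
  ring.
exists c, r, C'; have c0 : 0 < c.
  have := Cp (cV_cons (1, 0)); rewrite quad !mulmx0 !mxE expr1n mulr1 mulr0 !addr0.
  apply; apply/eqP => /(congr1 (@cV_uncons R n)); rewrite cV_consK => -[].
  by rewrite !mxE => /eqP; rewrite oner_eq0.
split => //; split.
  by rewrite linearB/= linearZ/= trmx_mul trmxK C's.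
(* This first coordinate minimizes the form of [C] over all vectors with tail [v]; the minimum is
   the form of the Schur complement at [v]. *)
move=> v v0; have := Cp (cV_cons (- c^-1 * (r^T *m v) 0 0, v)); rewrite quad.
have vr : (v^T *m (r *m r^T) *m v) 0 0 = ((r^T *m v) 0 0) ^+ 2.
  rewrite mulmxA -mulmxA -[v^T *m r]trmxK trmx_mul trmxK [r^T *m v]mx11_scalar.
  by rewrite tr_scalar_mx -scalar_mxM !mxE !eqxx !mulr1n expr2.
move=> H; rewrite mulmxBr mulmxBl -scalemxAr -scalemxAl.
have mxB (M N : 'M[R]_1) (e : R) : (M - e *: N) 0 0 = M 0 0 - e * N 0 0 by rewrite !mxE.
rewrite mxB vr.
suff <- : c * (- (c)^-1 * (r^T *m v) 0 0) ^+ 2 +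
    2 * (- (c)^-1 * (r^T *m v) 0 0) * (r^T *m v) 0 0 +
    (v^T *m C' *m v) 0 0 = (v^T *m C' *m v) 0 0 - (c)^-1 * (r^T *m v) 0 0 ^+ 2.
  apply: H; apply: contra_neq v0 => /(congr1 (@cV_uncons R n)); rewrite cV_consK => -[_ ->].
  by apply/colP => i; rewrite !mxE.
by field; rewrite gt_eqF.
Qed.

(** A triangular factor is wanted, rather than a symmetric square root, so that [ge0_integral_trig]
    applies. The tail [L'] is the factor of the Schur complement, and the column [a^-1 *: r]
    supplies the rank-one term subtracted there. *)
Lemma cholesky n (C : 'M[R]_n) : posdefmx C ->
  exists L : 'M[R]_n,
  [/\ is_trig_mx L, forall i, 0 < L i i & L *m L^T = C].
Proof.
elim: n C => [|n IH] C pC.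
  exists 0; split => [|[]//|]; first by apply/is_trig_mxP => -[].
  by apply/matrixP => -[].
have [c [r [C' [c0 pS CE]]]] := posdefmx_cV_cons pC.
have [L' [tL' L'0 LS]] := IH _ pS.
pose a := Num.sqrt c.
have a0 : 0 < a by rewrite sqrtr_gt0.
have aa : a * a = c by rewrite -expr2 sqr_sqrtr// ltW.
exists (@block_mx _ 1 n 1 n a%:M 0 (a^-1 *: r) L'); split.
- rewrite (@is_trig_block_mx _ 1 n 1 n)// eqxx/= tL' andbT.
  by apply/is_trig_mxP => i j; rewrite !ord1.
- move=> i; case: (split_ordP (i : 'I_(1 + n))) => k ->.
    by rewrite (@block_mxEul _ 1 n 1 n) ord1 mxE eqxx mulr1n.
  by rewrite (@block_mxEdr _ 1 n 1 n).
- rewrite (@tr_block_mx _ 1 n 1 n) (@mulmx_block _ 1 n 1 n 1 n) CE.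
  rewrite tr_scalar_mx trmx0 !(mul0mx, mulmx0, addr0) -scalar_mxM aa.
  rewrite linearZ/= mul_scalar_mx mul_mx_scalar !scalerA.
  rewrite mulfV ?scale1r ?gt_eqF// LS -scalemxAl -scalemxAr scalerA.
  by rewrite -invfM aa addrC subrK.
Qed.

End cV_cons_products.

(** * Multivariate normal integrals *)

Section multinormal_integral.
Variable R : realType.

Lemma multinormal_pdf_ge0 n (m : 'cV[R]_n) C x : 0 <= multinormal_pdf m C x.
Proof. by rewrite /multinormal_pdf mulr_ge0 ?expR_ge0// invr_ge0 sqrtr_ge0. Qed.

Lemma measurable_multinormal_pdf n (m : 'cV[R]_n) C :
  measurable_fun setT (multinormal_pdf m C).
Proof.
rewrite /multinormal_pdf; apply: measurable_funM => //.
apply: measurableT_comp => //; apply: measurable_funM => //.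
apply: measurableT_comp => //; apply: measurable_fun_entry.
have mB : measurable_fun setT (fun x : 'cV[R]_n => x - m).
  by apply: measurable_addmx.
apply: measurable_mulmx => //; apply: measurable_mulmx => //.
exact: measurable_trmx.
Qed.

Lemma standard_multinormal_pdf_cons n t (v : 'cV[R]_n) :
  multinormal_pdf 0 1%:M (cV_cons (t, v)) =
  (Num.sqrt (2 * pi))^-1 * expR (- t ^+ 2 / 2) * multinormal_pdf 0 1%:M v.
Proof.
rewrite /multinormal_pdf !subr0 !invmx1 !mulmx1 !det1 !mulr1 cV_cons_mul.
rewrite exprS sqrtrM ?mulr_ge0 ?pi_ge0// invfM -!mulrA; congr (_ * _).
rewrite [RHS]mulrCA -expRD; congr (_ * expR _).
by rewrite !mxE eqxx mulr1n expr2; field.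
Qed.

Lemma multinormal_pdf_cholesky n (m : 'cV[R]_n) (C L : 'M[R]_n) y :
  0 < \det L -> L *m L^T = C ->
  \det L * multinormal_pdf m C (L *m y + m) = multinormal_pdf 0 1%:M y.
Proof.
move=> L0 LC; have uL : L \in unitmx by rewrite unitmxE unitfE gt_eqF.
have detC : \det C = \det L ^+ 2 by rewrite -LC det_mulmx det_tr expr2.
have uC : C \in unitmx by rewrite unitmxE unitfE detC expf_neq0// gt_eqF.
rewrite /multinormal_pdf addrK subr0 invmx1 det1 mulr1 mulmx1 detC.
rewrite sqrtrM ?exprn_ge0 ?mulr_ge0 ?pi_ge0// sqrtr_sqr gtr0_norm// invfM.
rewrite [_^-1 * (\det L)^-1]mulrC !mulrA mulfV ?gt_eqF// mul1r.
suff LCL : L^T *m invmx C *m L = 1%:M.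
  by rewrite trmx_mul -2!mulmxA (mulmxA L^T) (mulmxA (L^T *m _)) LCL mul1mx.
apply: (can_inj (mulKmx uL)).
by rewrite mulmx1 !mulmxA LC mulmxV// mul1mx.
Qed.

Local Open Scope ereal_scope.

Lemma ge0_integral_multinormal_trig n (L : 'M[R]_n) (m : 'cV[R]_n)
    (F : 'cV[R]_n -> \bar R) :
  is_trig_mx L -> (forall i, (0 < L i i)%R) ->
  measurable_fun setT F -> (forall x, 0 <= F x) ->
  \int[lebesgue_cV R n]_x (F x * (multinormal_pdf m (L *m L^T) x)%:E) =
  \int[lebesgue_cV R n]_y (F (L *m y + m)%R * (multinormal_pdf 0 1%:M y)%:E).
Proof.
move=> tL L0 mF F0; set C := (L *m L^T)%R.
have mFp : measurable_fun setT (fun x => F x * (multinormal_pdf m C x)%:E).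
  apply: emeasurable_funM => //; apply/measurable_EFinP.
  exact: measurable_multinormal_pdf.
have Fp0 x : 0 <= F x * (multinormal_pdf m C x)%:E.
  by rewrite mule_ge0// lee_fin multinormal_pdf_ge0.
have dL : (0 < \det L)%R by rewrite det_trig//; apply: prodr_gt0.
rewrite (ge0_integral_trig m tL L0)// -ge0_integralZl_EFin ?(ltW dL)//; last first.
  exact: (measurableT_comp mFp (measurable_affine_mx _ _ (@measurable_id _ _ setT))).
apply: eq_integral => y _.
by rewrite muleCA -EFinM multinormal_pdf_cholesky.
Qed.

(** The value is squared mean plus variance: the mean is [\tr G + m] and the variance
    [2 * \tr (G *m G) + w^T w]. For a fixed first coordinate [t] the polynomial in the others is
    again quadratic, with linear coefficient and constant depending on [t], so the induction is
    uniform in [w] and [m]. *)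
Lemma integral_standard_multinormal_quadratic n (G : 'M[R]_n) (w : 'cV[R]_n) m :
  (G^T = G)%R ->
  \int[lebesgue_cV R n]_y
    ((((y^T *m G *m y) 0%R 0%R + (w^T *m y) 0%R 0%R + m) ^+ 2)%R%:E *
      (multinormal_pdf 0 1%:M y)%:E) =
  ((\tr G + m) ^+ 2 + 2 * \tr (G *m G) + (w^T *m w) 0%R 0%R)%R%:E.
Proof.
have mq k (G' : 'M[R]_k) (w' : 'cV[R]_k) m' : measurable_fun setT (fun y : 'cV[R]_k =>
    (((y^T *m G' *m y) 0 0 + (w'^T *m y) 0 0 + m') ^+ 2)%R).
  by apply: measurable_funX; exact: measurable_quadratic.
have mF k (G' : 'M[R]_k) (w' : 'cV[R]_k) m' : measurable_fun setT (fun y : 'cV[R]_k =>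
    (((y^T *m G' *m y) 0 0 + (w'^T *m y) 0 0 + m') ^+ 2)%R%:E *
      (multinormal_pdf 0 1%:M y)%:E).
  apply/measurable_EFinP/measurable_funM; first exact: mq.
  exact: measurable_multinormal_pdf.
have F0 k (G' : 'M[R]_k) (w' : 'cV[R]_k) m' y :
    0 <= (((y^T *m G' *m y) 0 0 + (w'^T *m y) 0 0 + m') ^+ 2)%R%:E *
      (multinormal_pdf 0 1%:M y)%:E.
  by rewrite mule_ge0 ?lee_fin ?sqr_ge0 ?multinormal_pdf_ge0.
elim: n G w m => [|n IH] G w m Gs.
  rewrite ge0_integral_lebesgue_cV0; last exact: mF.
  rewrite /multinormal_pdf expr0 det_mx00 mulr1 sqrtr1 invr1 mul1r -EFinM.
  rewrite !mxE /mxtrace !big_ord0 !(mulr0, add0r, addr0).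
  by rewrite oppr0 mul0r expR0 mulr1.
have [g [r [G' [_ G's trG trGG GcE]]]] := symmx_cV_cons Gs.
have [w0 [w' wE]] : exists w0 w', w = cV_cons (w0, w').
  by exists (cV_uncons w).1, (cV_uncons w).2; rewrite -surjective_pairing cV_unconsK.
rewrite ge0_integral_lebesgue_cVS; [|exact: mF|exact: F0].
pose phi t := ((Num.sqrt (2 * pi))^-1 * expR (- t ^+ 2 / 2) : R)%R.
have phi0 t : (0 <= phi t)%R by rewrite mulr_ge0 ?expR_ge0// invr_ge0 sqrtr_ge0.
have innerC k (x y : 'cV[R]_k) : ((x^T *m y) 0 0 = (y^T *m x) 0 0)%R.
  by rewrite !mxE; apply: eq_bigr => i _; rewrite !mxE mulrC.
(* The value of the inner integral according to the induction hypothesis: a quartic in [t],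
   nonnegative because [\tr (G' *m G')] is a sum of squares for symmetric [G']. *)
pose p t := ((\tr G' + (g * t ^+ 2 + w0 * t + m)) ^+ 2 + 2 * \tr (G' *m G') +
  ((w' + (2 * t) *: r)^T *m (w' + (2 * t) *: r)) 0 0)%R.
have add00 (M N : 'M[R]_1) : ((M + N) 0 0 = M 0 0 + N 0 0)%R by rewrite mxE.
have scale00 c (M : 'M[R]_1) : ((c *: M) 0 0 = c * M 0 0)%R by rewrite mxE.
have scalar00 c : ((c%:M : 'M[R]_1) 0 0 = c)%R by rewrite mxE eqxx mulr1n.
have inner_ge0 k (x : 'cV[R]_k) : (0 <= (x^T *m x) 0 0)%R.
  by rewrite !mxE sumr_ge0// => i _; rewrite !mxE -expr2 sqr_ge0.
have p_ge0 t : (0 <= p t)%R.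
  rewrite /p !addr_ge0 ?sqr_ge0 ?mulr_ge0 //.
  rewrite -{1}G's /mxtrace sumr_ge0// => i _; rewrite !mxE sumr_ge0// => j _.
  by rewrite !mxE -expr2 sqr_ge0.
transitivity (\int[lebesgue_measure]_t (p t * phi t)%:E).
  apply: eq_integral => t _; rewrite mulrC EFinM -IH//.
  rewrite -ge0_integralZl_EFin//; last exact: mF.
  apply: eq_integral => v _; rewrite -!EFinM; congr EFin.
  rewrite standard_multinormal_pdf_cons -/(phi t) [LHS]mulrCA.
  congr (_ * (_ ^+ 2 * _))%R.
  rewrite -mulmxA GcE wE !cV_cons_mul mulmxDr -scalemxAr mulmxA linearD/= linearZ/=.
  rewrite mulmxDl -scalemxAl !(add00, scale00, scalar00) (innerC _ v r); ring.
pose S := ((w'^T *m r) 0 0)%R; pose Q := ((r^T *m r) 0 0)%R.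
pose W := ((w'^T *m w') 0 0)%R; pose A := (\tr (G' *m G'))%R; pose al := (\tr G' + m)%R.
have pE t : p t = ((al ^+ 2 + 2 * A + W) + (2 * al * w0 + 4 * S) * t +
    (w0 ^+ 2 + 2 * al * g + 4 * Q) * t ^+ 2 + (2 * g * w0) * t ^+ 3 + g ^+ 2 * t ^+ 4)%R.
  have -> : p t = ((al + (g * t ^+ 2 + w0 * t)) ^+ 2 + 2 * A +
      ((w'^T + (2 * t) *: r^T) *m (w' + (2 * t) *: r)) 0 0)%R.
    have -> : (w'^T + (2 * t) *: r^T = (w' + (2 * t) *: r)^T)%R by rewrite linearD/= linearZ.
    by rewrite /p /al /A; congr (_ ^+ 2 + _ + _)%R; ring.
  rewrite mulmxDl !mulmxDr -!scalemxAl -!scalemxAr.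
  rewrite !(add00, scale00) (innerC _ r w') -/S -/Q -/W -/A /al; ring.
under eq_integral do rewrite pE.
rewrite integral_normal_quartic; last by move=> t; rewrite -pE.
congr EFin; rewrite trG trGG wE cV_cons_mul add00 scalar00 -/Q -/W -/A /al; ring.
Qed.

End multinormal_integral.

(** * Positive definite matrices *)

Section posdefmx_theory.
Variables (R : realType) (n : nat).
Implicit Types C D : 'M[R]_n.

Lemma posdefmx_unit C : posdefmx C -> C \in unitmx.
Proof.
move=> [Cs Cp]; rewrite -row_free_unit -kermx_eq0; apply/rowV0P => v vC.
apply: contrapT => /eqP v0; have := Cp v^T; rewrite trmxK trmx_eq0 => /(_ v0).
by move/sub_kermxP : vC => ->; rewrite mul0mx mxE ltxx.
Qed.

Lemma posdefmxD C D : posdefmx C -> posdefmx D -> posdefmx (C + D).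
Proof.
move=> [Cs Cp] [Ds Dp]; split; first by rewrite linearD/= Cs Ds.
by move=> x x0; rewrite mulmxDr mulmxDl mxE addr_gt0 ?Cp ?Dp.
Qed.

Lemma posdefmx_scalar (a : R) : 0 < a -> posdefmx (a%:M : 'M[R]_n).
Proof.
move=> a0; split; first exact: tr_scalar_mx.
move=> x x0; rewrite mul_mx_scalar -scalemxAl mxE mulr_gt0// lt_def.
have inner_ge0 i : true -> 0 <= x^T 0 i * x i 0 by rewrite mxE -expr2 sqr_ge0.
rewrite mxE sumr_ge0// andbT psumr_eq0//; apply: contraNN x0 => /allP x0.
apply/eqP/colP => i; rewrite mxE; have := x0 i (mem_index_enum _).
by rewrite mxE mulf_eq0 orbb => /eqP.
Qed.

Lemma trmx_invmx_sym C : C^T = C -> (invmx C)^T = invmx C.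
Proof. by move=> Cs; rewrite trmx_inv Cs. Qed.

Lemma posdefmx_det C : posdefmx C -> 0 < \det C.
Proof.
move=> /cholesky[L [tL L0 <-]]; rewrite det_mulmx det_tr -expr2 exprn_gt0//.
by rewrite det_trig// prodr_gt0.
Qed.

End posdefmx_theory.

(** * Second moments of quadratic polynomials under normal laws *)

Section multinormal_moments.
Variables (R : realType) (n : nat).
Local Open Scope ereal_scope.

(** Again squared mean plus variance. Substituting [L *m y + m], with [L] the Cholesky factor of
    [C], turns [G] into [L^T *m G *m L], the linear coefficient into [L^T] times the gradient
    [w + 2 *: (G *m m)] at the mean, and the constant into the value at the mean. Cyclicity of the
    trace then makes [L] appear only as [L *m L^T]. *)
Lemma integral_multinormal_quadratic (C G : 'M[R]_n) (m w : 'cV[R]_n) (c : R) :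
  posdefmx C -> (G^T = G)%R ->
  \int[lebesgue_cV R n]_x
    ((((x^T *m G *m x) 0%R 0%R + (w^T *m x) 0%R 0%R + c) ^+ 2)%R%:E *
      (multinormal_pdf m C x)%:E) =
  ((\tr (G *m C) + (m^T *m G *m m) 0 0 + (w^T *m m) 0 0 + c) ^+ 2 +
   2 * \tr (G *m C *m (G *m C)) +
   ((w + 2 *: (G *m m))^T *m C *m (w + 2 *: (G *m m))) 0 0)%R%:E.
Proof.
move=> /cholesky[L [tL L0 LC]] Gs; rewrite -LC.
pose F (x : 'cV[R]_n) := ((((x^T *m G *m x) 0 0 + (w^T *m x) 0 0 + c) ^+ 2)%R%:E).
rewrite (@ge0_integral_multinormal_trig _ _ L m F)//; last 2 first.
  by apply/measurable_EFinP/measurable_funX/measurable_quadratic.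
  by move=> x; rewrite lee_fin sqr_ge0.
set w' := (w + 2 *: (G *m m))%R.
pose c' := ((m^T *m G *m m) 0 0 + (w^T *m m) 0 0 + c)%R.
have G's : ((L^T *m G *m L)^T = L^T *m G *m L)%R.
  by rewrite !trmx_mul trmxK Gs mulmxA.
transitivity (\int[lebesgue_cV R n]_y
    ((((y^T *m (L^T *m G *m L) *m y) 0%R 0%R + ((L^T *m w')^T *m y) 0%R 0%R + c') ^+ 2)%R%:E *
      (multinormal_pdf 0 1%:M y)%:E)).
  apply: eq_integral => y _; congr (_ * _); rewrite /F; congr (_ ^+ 2)%R%:E.
  have add00 (M N : 'M[R]_1) : ((M + N) 0 0 = M 0 0 + N 0 0)%R by rewrite mxE.
  have scale00 a (M : 'M[R]_1) : ((a *: M) 0 0 = a * M 0 0)%R by rewrite mxE.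
  have wT : (w'^T = w^T + 2 *: (m^T *m G))%R.
    by rewrite linearD/= linearZ/= trmx_mul Gs.
  have -> : (y^T *m (L^T *m G *m L) *m y = (L *m y)^T *m G *m (L *m y))%R.
    by rewrite trmx_mul !mulmxA.
  have -> : ((L^T *m w')^T *m y = w'^T *m (L *m y))%R.
    by rewrite trmx_mul trmxK mulmxA.
  set z := (L *m y)%R; have swap : ((m^T *m G *m z) 0 0 = (z^T *m G *m m) 0 0)%R.
    have -> : (m^T *m G *m z = (z^T *m G *m m)^T)%R by rewrite !trmx_mul !trmxK Gs mulmxA.
    by rewrite mxE.
  have -> : ((z + m)^T = z^T + m^T)%R by rewrite linearD.
  rewrite wT !mulmxDl !mulmxDr -!scalemxAl !add00 !scale00 /c' -swap; ring.
rewrite integral_standard_multinormal_quadratic//; congr EFin.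
have -> : (\tr (L^T *m G *m L) = \tr (G *m (L *m L^T)))%R.
  by rewrite [LHS]mxtrace_mulC [RHS]mxtrace_mulC mulmxA.
have -> : (\tr (L^T *m G *m L *m (L^T *m G *m L)) =
    \tr (G *m (L *m L^T) *m (G *m (L *m L^T))))%R.
  by rewrite -!mulmxA [LHS]mxtrace_mulC -!mulmxA.
have -> : ((L^T *m w')^T *m (L^T *m w') = w'^T *m (L *m L^T) *m w')%R.
  by rewrite trmx_mul trmxK !mulmxA.
by rewrite /c' !addrA.
Qed.

Lemma integral_multinormal_pdf (C : 'M[R]_n) m : posdefmx C ->
  \int[lebesgue_cV R n]_x (multinormal_pdf m C x)%:E = 1.
Proof.
move=> Cp; have := @integral_multinormal_quadratic C 0%R m 0%R 1%R Cp (trmx0 _ _ _).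
under eq_integral do
  rewrite mulmx0 mul0mx trmx0 mul0mx !mxE !add0r expr1n mul1e.
move=> ->; rewrite mulmx0 !mul0mx scaler0 addr0 !trmx0 !mul0mx !mxtrace0 !mxE.
by rewrite mulr0 !add0r !addr0 expr1n.
Qed.

End multinormal_moments.

(** * Convolution of normal laws *)

Section convolution.
Variables (R : realType) (n : nat).
Variables (sigma : R) (m : 'cV[R]_n) (C : 'M[R]_n).
Hypotheses (sigma0 : 0 < sigma) (Cp : posdefmx C).
Let D := C + (sigma ^+ 2)%:M.

Let Dp : posdefmx D.
Proof. by apply: posdefmxD => //; apply: posdefmx_scalar; rewrite exprn_gt0. Qed.

(* completing the square in [x] *)
Let exponent_split (x w : 'cV[R]_n) :
  let K := invmx C + (sigma ^- 2)%:M in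
  let y := m + C *m invmx D *m (w - m) in
  ((w - x)^T *m invmx ((sigma ^+ 2)%:M) *m (w - x)) 0 0 +
  ((x - m)^T *m invmx C *m (x - m)) 0 0 =
  ((x - y)^T *m K *m (x - y)) 0 0 + ((w - m)^T *m invmx D *m (w - m)) 0 0.
Proof.
(* In probabilistic terms, [E] is the regression matrix of [X] on [X + sigma *: Z], while [y] and
   [K] are the conditional mean and precision of [X] given the value [w] of this sum. The cross
   terms match because [K *m E] is the scalar matrix [sigma ^- 2]. *)
move=> K y; pose E := C *m invmx D.
have uC := posdefmx_unit Cp; have uD := posdefmx_unit Dp.
have s0 : sigma ^+ 2 != 0 by rewrite expf_neq0// gt_eqF.
have Cs := Cp.1; have Ds := Dp.1.
have KC : K *m C = sigma ^- 2 *: D.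
  rewrite mulmxDl mulVmx// mul_scalar_mx /D scalerDr scale_scalar_mx mulVf//.
  by rewrite addrC.
have KE : K *m E = (sigma ^- 2)%:M.
  by rewrite mulmxA KC -scalemxAl mulmxV// scalemx1.
have Ks : K^T = K.
  by rewrite linearD/= tr_scalar_mx trmx_invmx_sym.
have EK : E^T *m K = (sigma ^- 2)%:M.
  by rewrite -{1}Ks -trmx_mul KE tr_scalar_mx.
have ED : sigma ^- 2 *: E + invmx D = (sigma ^- 2)%:M.
  have -> : invmx D = sigma ^- 2 *: (sigma ^+ 2 *: invmx D).
    by rewrite scalerA mulVf// scale1r.
  by rewrite -scalerDr -[sigma ^+ 2 *: _]mul_scalar_mx -mulmxDl mulmxV// scalemx1.
set u := w - m; set v := x - m.
have -> : w - x = u - v by rewrite /u /v opprB addrA subrK.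
have -> : x - y = v - E *m u by rewrite /y opprD addrA.
clearbody u v.
have add00 (M N : 'M[R]_1) : (M + N) 0 0 = M 0 0 + N 0 0 by rewrite mxE.
have scale00 a (M : 'M[R]_1) : (a *: M) 0 0 = a * M 0 0 by rewrite mxE.
have opp00 (M : 'M[R]_1) : (- M) 0 0 = - M 0 0 by rewrite mxE.
have quadB (M : 'M[R]_n) (a b : 'cV[R]_n) : (a - b)^T *m M *m (a - b) =
    a^T *m M *m a - a^T *m M *m b - (b^T *m M *m a - b^T *m M *m b).
  by rewrite [(a - b)^T]linearB/= !mulmxBl !mulmxBr.
have vEu : v^T *m K *m (E *m u) = sigma ^- 2 *: (v^T *m u).
  by rewrite -mulmxA (mulmxA K) KE mul_scalar_mx -scalemxAr.
have Euv : (E *m u)^T *m K *m v = sigma ^- 2 *: (u^T *m v).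
  by rewrite trmx_mul -(mulmxA u^T) EK mul_mx_scalar scalemxAl.
have EuEu : (E *m u)^T *m K *m (E *m u) = sigma ^- 2 *: (u^T *m u) - u^T *m invmx D *m u.
  have -> : invmx D = (sigma ^- 2)%:M - sigma ^- 2 *: E by rewrite -ED addrAC subrr add0r.
  rewrite trmx_mul -(mulmxA _ E^T) EK mulmxBr mulmxBl !mul_mx_scalar.
  by rewrite -scalemxAr -!scalemxAl opprB addrC subrK mulmxA.
have vKv : v^T *m K *m v = v^T *m invmx C *m v + sigma ^- 2 *: (v^T *m v).
  by rewrite mulmxDr mulmxDl mul_mx_scalar -scalemxAl.
rewrite !quadB vEu Euv EuEu vKv invmx_scalar !mul_mx_scalar -!scalemxAl.
rewrite !(add00, opp00, scale00); ring.
Qed.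

(** The variable [x] is left only in a Gaussian factor whose centre depends on [w] but whose shape
    does not. *)
Let pdf_mul (x w : 'cV[R]_n) :
  multinormal_pdf x (sigma ^+ 2)%:M w * multinormal_pdf m C x =
  (Num.sqrt ((2 * pi) ^+ n * \det ((sigma ^+ 2)%:M : 'M[R]_n)))^-1 *
  (Num.sqrt ((2 * pi) ^+ n * \det C))^-1 * Num.sqrt ((2 * pi) ^+ n * \det D) *
  expR (- ((x - (m + C *m invmx D *m (w - m)))^T *m (invmx C + (sigma ^- 2)%:M) *m
           (x - (m + C *m invmx D *m (w - m)))) 0 0 / 2) * multinormal_pdf m D w.
Proof.
have E (a b a' b' : R) : a + b = a' + b' ->
    expR (- a / 2) * expR (- b / 2) = expR (- a' / 2) * expR (- b' / 2).
  by move=> ab; rewrite -!expRD -!mulrDl -!opprD ab.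
rewrite /multinormal_pdf mulrACA (E _ _ _ _ (exponent_split x w)).
have N0 : Num.sqrt ((2 * pi) ^+ n * \det D) != 0.
  by rewrite gt_eqF// sqrtr_gt0 mulr_gt0 ?posdefmx_det// exprn_gt0// mulr_gt0 ?pi_gt0.
set i1 := (Num.sqrt (_ * \det (_%:M)))^-1; set i2 := (Num.sqrt (_ * \det C))^-1.
by field.
Qed.

Local Open Scope ereal_scope.

(** By translation invariance the integral of the Gaussian factor in [x] does not depend on its
    centre, hence not on [w]. Its value is left as an unknown [k], a priori possibly infinite, which
    avoids evaluating the determinant of the precision matrix [K]. *)
Let kernel_integral : exists2 k : \bar R, 0 <= k & forall w,
  \int[lebesgue_cV R n]_x
    (multinormal_pdf x (sigma ^+ 2)%:M w * multinormal_pdf m C x)%:E =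
  k * (multinormal_pdf m D w)%:E.
Proof.
set K := (invmx C + (sigma ^- 2)%:M)%R.
set c := ((Num.sqrt ((2 * pi) ^+ n * \det ((sigma ^+ 2)%:M : 'M[R]_n)))^-1 *
  (Num.sqrt ((2 * pi) ^+ n * \det C))^-1 * Num.sqrt ((2 * pi) ^+ n * \det D))%R.
have c0 : (0 <= c)%R by rewrite !mulr_ge0 ?invr_ge0 ?sqrtr_ge0.
pose g (x : 'cV[R]_n) := (expR (- (x^T *m K *m x) 0 0 / 2))%R.
have mg y : measurable_fun setT (fun x : 'cV[R]_n => (g (x - y)%R)%:E).
  apply/measurable_EFinP; rewrite /g.
  apply: measurableT_comp => //; apply: measurable_funM => //.
  apply: measurableT_comp => //; apply: measurable_fun_entry.
  have mB : measurable_fun setT (fun x : 'cV[R]_n => x - y)%R by apply: measurable_addmx.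
  apply: measurable_mulmx => //; apply: measurable_mulmx => //.
  exact: measurable_trmx.
exists (c%:E * \int[lebesgue_cV R n]_x (g x)%:E).
  by rewrite mule_ge0// integral_ge0// => x _; rewrite lee_fin expR_ge0.
move=> w; set y := (m + C *m invmx D *m (w - m))%R.
have tr1 : is_trig_mx (1%:M : 'M[R]_n) by exact: scalar_mx_is_trig.
have pos1 i : (0 < (1%:M : 'M[R]_n) i i)%R by rewrite mxE eqxx.
have mg0 : measurable_fun setT (fun x => (g x)%:E).
  by apply: eq_measurable_fun (mg 0%R) => x _; rewrite subr0.
have g0 x : 0 <= (g x)%:E by rewrite lee_fin expR_ge0.
(* Translation invariance is the triangular change of variables with identity matrix. *)
rewrite (ge0_integral_trig (- y)%R tr1 pos1 mg0 g0).
rewrite det1 mul1e -ge0_integralZl_EFin//; last first.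
  by apply: eq_measurable_fun (mg y) => x _; rewrite mul1mx.
rewrite -ge0_integralZr.
- by apply: eq_integral => x _; rewrite pdf_mul mul1mx -!EFinM.
- exact: measurableT.
- apply: measurable_funeM.
  by apply: eq_measurable_fun (mg y) => x _; rewrite mul1mx.
- by move=> x _; rewrite mule_ge0// lee_fin ?expR_ge0.
- by rewrite lee_fin multinormal_pdf_ge0.
Qed.

(* The constant of [kernel_integral] is 1 because both sides have total mass 1. *)
Lemma multinormal_convolution (F : 'cV[R]_n -> \bar R) :
  measurable_fun setT F -> (forall x, 0 <= F x) ->
  \int[lebesgue_cV R n]_x
    ((\int[lebesgue_cV R n]_z
       (F (x + sigma *: z)%R * (multinormal_pdf 0 1%:M z)%:E)) *
     (multinormal_pdf m C x)%:E) =
  \int[lebesgue_cV R n]_w (F w * (multinormal_pdf m D w)%:E).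
Proof.
have [k k0 kE] := kernel_integral.
have convE (H : 'cV[R]_n -> \bar R) : measurable_fun setT H -> (forall x, 0 <= H x) ->
  \int[lebesgue_cV R n]_x
    ((\int[lebesgue_cV R n]_z
       (H (x + sigma *: z)%R * (multinormal_pdf 0 1%:M z)%:E)) *
     (multinormal_pdf m C x)%:E) =
  k * \int[lebesgue_cV R n]_w (H w * (multinormal_pdf m D w)%:E).
  move=> mH H0.
  have sT : is_trig_mx (sigma%:M : 'M[R]_n) by exact: scalar_mx_is_trig.
  have sp i : (0 < (sigma%:M : 'M[R]_n) i i)%R by rewrite mxE eqxx.
  have sE : (sigma%:M *m sigma%:M^T = (sigma ^+ 2)%:M :> 'M[R]_n)%R.
    by rewrite tr_scalar_mx -scalar_mxM expr2.
  pose f (xw : 'cV[R]_n * 'cV[R]_n) := H xw.2 *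
    (multinormal_pdf xw.1 (sigma ^+ 2)%:M xw.2 * multinormal_pdf m C xw.1)%:E.
  have mf : measurable_fun setT f.
    apply: emeasurable_funM; first exact: (measurableT_comp mH measurable_snd).
    apply/measurable_EFinP/measurable_funM; last first.
      exact: (measurableT_comp (measurable_multinormal_pdf m C) measurable_fst).
    have mB : measurable_fun setT (fun xw : 'cV[R]_n * 'cV[R]_n => xw.2 - xw.1)%R.
      apply: measurable_addmx; first exact: measurable_snd.
      by apply: measurable_oppmx; exact: measurable_fst.
    have := measurableT_comp (measurable_multinormal_pdf 0 (sigma ^+ 2)%:M) mB.
    by apply: eq_measurable_fun => xw _ /=; rewrite /multinormal_pdf subr0.
  have f0 xw : 0 <= f xw.
    by rewrite mule_ge0// lee_fin mulr_ge0// multinormal_pdf_ge0.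
  transitivity (\int[lebesgue_cV R n]_x \int[lebesgue_cV R n]_w f (x, w)).
    apply: eq_integral => x _.
    have -> : \int[lebesgue_cV R n]_z
        (H (x + sigma *: z)%R * (multinormal_pdf 0 1%:M z)%:E) =
        \int[lebesgue_cV R n]_w (H w * (multinormal_pdf x (sigma ^+ 2)%:M w)%:E).
      rewrite -sE (ge0_integral_multinormal_trig _ sT sp mH H0); apply: eq_integral => z _.
      by rewrite mul_scalar_mx addrC.
    rewrite -ge0_integralZr.
    - by apply: eq_integral => w _; rewrite -muleA -EFinM.
    - exact: measurableT.
    - apply: emeasurable_funM; first exact: mH.
      by apply/measurable_EFinP; exact: measurable_multinormal_pdf.
    - by move=> w _; rewrite mule_ge0// lee_fin multinormal_pdf_ge0.
    - by rewrite lee_fin multinormal_pdf_ge0.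
  rewrite (fubini_tonelli _ mf f0) -ge0_integralZl.
  - apply: eq_integral => w _; rewrite muleCA -kE -ge0_integralZl.
    + by [].
    + exact: measurableT.
    + apply/measurable_EFinP/measurable_funM; last exact: measurable_multinormal_pdf.
      have mB : measurable_fun setT (fun x : 'cV[R]_n => w - x)%R.
        by apply: measurable_addmx; [exact: measurable_cst|exact: measurable_oppmx].
      have := measurableT_comp (measurable_multinormal_pdf 0 (sigma ^+ 2)%:M) mB.
      by apply: eq_measurable_fun => x _ /=; rewrite /multinormal_pdf subr0.
    + by move=> x _; rewrite lee_fin mulr_ge0// multinormal_pdf_ge0.
    + exact: H0.
  - exact: measurableT.
  - apply: emeasurable_funM; first exact: mH.
    by apply/measurable_EFinP; exact: measurable_multinormal_pdf.
  - by move=> w _; rewrite mule_ge0// lee_fin multinormal_pdf_ge0.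
  - exact: k0.
have k1 : k = 1.
  have := convE (cst 1) (measurable_cst _) (fun _ => lee01).
  under eq_integral.
    move=> x _; under eq_integral do rewrite mul1e.
    rewrite integral_multinormal_pdf ?mul1e//; last exact: posdefmx_scalar.
    over.
  under [in X in _ = X -> _]eq_integral do rewrite mul1e.
  by rewrite /= !integral_multinormal_pdf// mule1.
by move=> mF F0; rewrite convE// k1 mul1e.
Qed.

End convolution.

(** * The law of the smoothed features *)

Section independence.
Local Open Scope ereal_scope.
Context {disp : measure_display} {T : measurableType disp} {R : realType}
  (P : probability T R).

Lemma ge0_integral_independent d1 d2 (T1 : measurableType d1) (T2 : measurableType d2)
    (U : {RV P >-> T1}) (Z : {RV P >-> T2}) (G : T1 * T2 -> \bar R) :
  independent_RVs P U Z ->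
  measurable_fun setT G -> (forall x, 0 <= G x) ->
  \int[P]_w G (U w, Z w) = \int[P]_w \int[distribution P Z]_z G (U w, z).
Proof.
move=> ind mG G0.
have mUZ : measurable_fun setT (fun w => (U w, Z w)) by exact: measurable_fun_pair.
have := @ge0_integral_pushforward _ _ _ _ R _ mUZ P setT G measurableT mG (fun x _ => G0 x).
rewrite preimage_setT => <-.
rewrite (eq_measure_integral (distribution P U \x distribution P Z)); last first.
  move=> A mA _; apply/esym; apply: (product_measure_unique
    (m' := pushforward P (fun w => (U w, Z w)))) => //; exact: ind.
rewrite fubini_tonelli1//.
rewrite -(ge0_integral_distribution U (f := fun u => \int[distribution P Z]_z G (u, z)))//.
- exact: (@measurable_fun_fubini_tonelli_F _ _ _ _ _ (distribution P Z) _ mG G0).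
- by move=> x; exact: integral_ge0.
Qed.

(** The law of [X] restricted to the event [E] is kept unnormalized, so that the weight of a class
    is part of the density [f] and no division by the probability of [E] occurs. *)
Lemma ge0_integral_on_event d1 (T1 : measurableType d1) (X : {RV P >-> T1})
    (E : set T) (mE : measurable E)
    (mu : {measure set T1 -> \bar R}) (f : T1 -> R) (F : T1 -> \bar R) :
  (forall x, (0 <= f x)%R) -> measurable_fun setT f ->
  (forall A, measurable A -> P (X @^-1` A `&` E) = \int[mu]_(x in A) (f x)%:E) ->
  measurable_fun setT F -> (forall x, 0 <= F x) ->
  \int[P]_w (F (X w) * (\1_E w)%:E) = \int[mu]_x (F x * (f x)%:E).
Proof.
move=> f0 mf PE mF F0.
rewrite -(@ge0_integral_density _ _ _ (pushforward (mrestr P mE) X) mu f)//.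
have mX : measurable_fun setT X by [].
have := @ge0_integral_pushforward _ _ _ _ R _ mX (mrestr P mE) setT F measurableT mF
  (fun x _ => F0 x).
rewrite preimage_setT => ->.
rewrite (@ge0_integral_density _ _ _ (mrestr P mE) P \1_E)//.
- by move=> A mA; rewrite integral_indic// setIC.
- by move=> x; exact: F0.
- exact: measurableT_comp.
Qed.

End independence.

Section mixture.
Context {disp : measure_display} {T : measurableType disp} {R : realType}
  (P : probability T R).
Variables (d : nat) (p sigma : R) (mu : bool -> 'cV[R]_d) (Sigma : bool -> 'M[R]_d).
Variables (S : {RV P >-> bool}) (X Z : {RV P >-> 'cV[R]_d}).
Hypothesis p01 : 0 < p < 1.
Hypothesis sigma0 : 0 < sigma.
Hypothesis Sigma_posdef : forall k, posdefmx (Sigma k).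
Hypothesis S_law : forall A, distribution P S A = bernoulli_prob p A.
Hypothesis X_law : forall (k : bool) A, measurable A ->
  cond_prob P (X @^-1` A) (S @^-1` [set k]) = multinormal_prob (mu k) (Sigma k) A.
Hypothesis Z_law : forall A, measurable A ->
  distribution P Z A = multinormal_prob 0 1%:M A.
Hypothesis XSZ_independent : independent_RVs P (fun w => (X w, S w)) Z.

Let Xsigma := fun w : T => X w + sigma *: Z w.
Let weight (k : bool) : R := if k then p else 1 - p.
Let f k := multinormal_pdf (mu k) (tSigma sigma Sigma k).

Let weight_gt0 k : 0 < weight k.
Proof. by have /andP[? ?] := p01; rewrite /weight; case: k; rewrite ?subr_gt0. Qed.

Let prob_label k : P (S @^-1` [set k]) = (weight k)%:E.
Proof.
have := S_law [set k]; rewrite /distribution /pushforward => ->.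
have /andP[p0 p1] := p01; rewrite bernoulli_probE ?ltW//.
have inE1 b : (b \in [set k]) = (b == k).
  by apply/idP/eqP => [/set_mem//|->]; exact/mem_set.
by rewrite !diracE !inE1 {inE1}; case: k => /=; rewrite ?mule1 ?mule0 ?adde0 ?add0e.
Qed.

Lemma measurable_Xsigma : measurable_fun setT Xsigma.
Proof. by apply: measurable_addmx => //; exact: measurable_scalemx. Qed.

Local Open Scope ereal_scope.

(** On the event that the label is [k], [Xsigma] has density [weight k] times that of
    [N(mu k, tSigma k)]. Independence integrates [Z] out and leaves a function [H] of [X]; the class
    law of [X] and the convolution formula then give the normal density. *)
Lemma ge0_integral_label k (F : 'cV[R]_d -> \bar R) :
  measurable_fun setT F -> (forall x, 0 <= F x) ->
  \int[P]_w (F (Xsigma w) * (\1_(S @^-1` [set k]) w)%:E) =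
  (weight k)%:E * \int[lebesgue_cV R d]_x (F x * (f k x)%:E).
Proof.
move=> mF F0.
have mE : measurable (S @^-1` [set k]) by exact: measurable_funPTI.
pose H x := \int[distribution P Z]_z F (x + sigma *: z)%R.
have mplus : measurable_fun setT (fun xz : 'cV[R]_d * 'cV[R]_d => xz.1 + sigma *: xz.2)%R.
  apply: measurable_addmx; first exact: measurable_fst.
  by apply: measurable_scalemx => //; exact: measurable_snd.
have mH : measurable_fun setT H.
  apply: (@measurable_fun_fubini_tonelli_F _ _ _ _ _ (distribution P Z)
    (fun xz : 'cV[R]_d * 'cV[R]_d => F (xz.1 + sigma *: xz.2)%R)) => //.
  exact: (measurableT_comp mF mplus).
have H0 x : 0 <= H x by exact: integral_ge0.
have mXS : measurable_fun setT (fun w => (X w, S w)) by exact: measurable_fun_pair.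
pose XS : {RV P >-> ('cV[R]_d * bool)%type} :=
  HB.pack (fun w => (X w, S w)) (isMeasurableFun.Build _ _ _ _ _ mXS).
pose G (xsz : 'cV[R]_d * bool * 'cV[R]_d) :=
  F (xsz.1.1 + sigma *: xsz.2)%R * ((xsz.1.2 == k)%:R : R)%:E.
have G0 x : 0 <= G x by rewrite mule_ge0// lee_fin ler0n.
have mG : measurable_fun setT G.
  apply: emeasurable_funM.
    apply: (measurableT_comp mF (f := F)).
    apply: measurable_addmx; first exact: (measurableT_comp measurable_fst measurable_fst).
    by apply: measurable_scalemx => //; exact: measurable_snd.
  apply/measurable_EFinP.
  have mk : measurable_fun setT (fun b : bool => (b == k)%:R : R) by [].
  apply: (measurableT_comp mk).
  exact: (measurableT_comp measurable_snd measurable_fst).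
have indicE' w : \1_(S @^-1` [set k]) w = ((S w == k)%:R : R).
  rewrite indicE; congr (_%:R); congr nat_of_bool.
  by apply/idP/eqP => [/set_mem//|Sk]; exact/mem_set.
transitivity (\int[P]_w (H (X w) * (\1_(S @^-1` [set k]) w)%:E)).
  have := @ge0_integral_independent _ _ _ P _ _ _ _ XS Z G XSZ_independent mG G0.
  rewrite /G /= => GE.
  under eq_integral do rewrite indicE'.
  rewrite GE; apply: eq_integral => w _; rewrite indicE' ge0_integralZr.
  - by [].
  - exact: measurableT.
  - apply: (measurableT_comp mF); apply: measurable_addmx; first exact: measurable_cst.
    by apply: measurable_scalemx; [exact: measurable_cst|exact: measurable_id].
  - by move=> z _; exact: F0.
  - by rewrite lee_fin ler0n.
have weight0 := weight_gt0 k.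
(* The conditional law is multiplied back by the class probability, which is nonzero because
   [0 < p < 1]. *)
have PE A : measurable A -> P (X @^-1` A `&` S @^-1` [set k]) =
    \int[lebesgue_cV R d]_(x in A) (weight k * multinormal_pdf (mu k) (Sigma k) x)%:E.
  move=> mA; have := X_law k mA; rewrite /cond_prob prob_label /multinormal_prob => XE.
  under eq_integral do rewrite EFinM.
  rewrite ge0_integralZl_EFin.
  - rewrite -XE inver gt_eqF// muleCA -EFinM divff ?mule1// gt_eqF//.
  - exact: mA.
  - by move=> x _; rewrite lee_fin multinormal_pdf_ge0.
  - by apply: measurable_funTS; apply/measurable_EFinP; exact: measurable_multinormal_pdf.
  - exact: ltW.
have wf0 x : (0 <= weight k * multinormal_pdf (mu k) (Sigma k) x)%R.
  by rewrite mulr_ge0 ?multinormal_pdf_ge0// ltW.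
have mwf : measurable_fun setT (fun x => weight k * multinormal_pdf (mu k) (Sigma k) x)%R.
  by apply: measurable_funM; [exact: measurable_cst|exact: measurable_multinormal_pdf].
have HE x : H x = \int[lebesgue_cV R d]_z
    (F (x + sigma *: z)%R * (multinormal_pdf 0 1%:M z)%:E).
  rewrite /H (@ge0_integral_density _ _ _ (distribution P Z) (lebesgue_cV R d)
    (multinormal_pdf 0 1%:M)).
  - by [].
  - by move=> z; exact: multinormal_pdf_ge0.
  - exact: measurable_multinormal_pdf.
  - exact: Z_law.
  - by move=> z; exact: F0.
  - apply: (measurableT_comp mF); apply: measurable_addmx; first exact: measurable_cst.
    by apply: measurable_scalemx; [exact: measurable_cst|exact: measurable_id].
rewrite (ge0_integral_on_event mE wf0 mwf PE mH H0).
rewrite -(multinormal_convolution _ sigma0 (Sigma_posdef k) mF F0) -ge0_integralZl_EFin.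
- by apply: eq_integral => x _; rewrite -HE [in LHS]EFinM muleCA.
- exact: measurableT.
- by move=> x _; rewrite -HE mule_ge0 ?lee_fin ?multinormal_pdf_ge0.
- apply: emeasurable_funM.
    by apply: eq_measurable_fun mH => x _; exact: HE.
  by apply/measurable_EFinP; exact: measurable_multinormal_pdf.
- exact: ltW.
Qed.

End mixture.

(** * The posterior probability *)

Section sigmoid_theory.
Variable R : realType.
Implicit Types u v : R.

Lemma sigmoidE u : sigmoid u = expR u / (1 + expR u).
Proof.
rewrite /sigmoid expRN; have := expR_gt0 u; set e := expR u => e0.
by field; rewrite !gt_eqF// addr_gt0.
Qed.

Lemma sigmoid_ge0 u : 0 <= sigmoid u.
Proof. by rewrite sigmoidE divr_ge0 ?addr_ge0 ?expR_ge0. Qed.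

Lemma sigmoid_le1 u : sigmoid u <= 1.
Proof. by rewrite sigmoidE ler_pdivrMr ?mul1r ?lerDr// ltr_pwDl ?expR_ge0. Qed.

Lemma sigmoid_sub_sqr u v : (sigmoid u - sigmoid v) ^+ 2 <= 4^-1 * (u - v) ^+ 2.
Proof.
wlog vu : u v / v <= u.
  move=> H; have [|/ltW] := leP v u; first exact: H.
  by move/H; rewrite -(sqrrN (u - v)) -(sqrrN (sigmoid u - _)) !opprB.
have d0 : 0 <= (u - v) / 2 by rewrite divr_ge0 ?subr_ge0.
pose a := expR v; pose t := expR ((u - v) / 2).
have a0 : 0 < a := expR_gt0 _; have t0 : 0 < t := expR_gt0 _.
have ut : expR u = a * t ^+ 2.
  by rewrite -expRM_natl -expRD; congr expR; field.
have t1 : 1 <= t by rewrite -expR0 ler_expR.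
have tle : 1 - t^-1 <= (u - v) / 2.
  have := expR_ge1Dx (- ((u - v) / 2)); rewrite expRN -/t; lra.
have dE : sigmoid u - sigmoid v =
    (1 - t^-1) * ((a * t * (t + 1)) / ((1 + a * t ^+ 2) * (1 + a))).
  rewrite !sigmoidE ut -/a; field.
  by rewrite !gt_eqF// addr_gt0// mulr_gt0// exprn_gt0.
have q1 : (a * t * (t + 1)) / ((1 + a * t ^+ 2) * (1 + a)) <= 1.
  rewrite ler_pdivrMr; last by rewrite mulr_gt0// addr_gt0// mulr_gt0// exprn_gt0.
  rewrite mul1r -subr_ge0.
  have -> : (1 + a * t ^+ 2) * (1 + a) - a * t * (t + 1) =
     (1 - a * t) ^+ 2 + a * t + a by ring.
  by rewrite !addr_ge0 ?sqr_ge0// ?mulr_ge0// ltW.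
have q0 : 0 <= (a * t * (t + 1)) / ((1 + a * t ^+ 2) * (1 + a)).
  by rewrite divr_ge0 ?mulr_ge0 ?addr_ge0 ?mulr_ge0 ?exprn_ge0// ltW.
have s0 : 0 <= 1 - t^-1 by rewrite subr_ge0 invf_le1.
have -> : 4^-1 * (u - v) ^+ 2 = ((u - v) / 2) ^+ 2 by field.
have le1 := le_trans (ler_piMr s0 q1) tle.
by rewrite dE; apply: lerXn2r => //; rewrite nnegrE; exact: mulr_ge0.
Qed.

Lemma measurable_sigmoid : measurable_fun setT (@sigmoid R).
Proof.
apply: nondecreasing_measurable => // u v uv.
rewrite /sigmoid !div1r lef_pV2 ?posrE ?addr_gt0 ?expR_gt0//.
by rewrite lerD2l ler_expR lerN2.
Qed.

End sigmoid_theory.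

(** * Log odds and Bayes' rule *)

Section log_odds.
Variables (R : realType) (d : nat) (p sigma : R).
Variables (mu : bool -> 'cV[R]_d) (Sigma : bool -> 'M[R]_d).
Hypothesis p01 : 0 < p < 1.
Hypothesis tSigma_posdef : forall k, posdefmx (tSigma sigma Sigma k).

Definition log_odds (x : 'cV[R]_d) : R :=
  (x^T *m ccg_A sigma Sigma *m x) 0 0 + ((ccg_b sigma mu Sigma)^T *m x) 0 0 +
  ccg_c p sigma mu Sigma.

(** The odds identity in multiplicative form, so that no density has to be inverted or placed under
    a logarithm. *)
Lemma log_oddsP x :
  p * multinormal_pdf (mu true) (tSigma sigma Sigma true) x =
  expR (log_odds x) * ((1 - p) * multinormal_pdf (mu false) (tSigma sigma Sigma false) x).
Proof.
set D1 := tSigma sigma Sigma true; set D0 := tSigma sigma Sigma false.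
have D1p : 0 < \det D1 := posdefmx_det (tSigma_posdef true).
have D0p : 0 < \det D0 := posdefmx_det (tSigma_posdef false).
have /andP[p0 p1] := p01; have pb0 : 0 < 1 - p by rewrite subr_gt0.
have quadB (M : 'M[R]_d) (a b : 'cV[R]_d) : M^T = M ->
    ((a - b)^T *m M *m (a - b)) 0 0 =
    (a^T *m M *m a) 0 0 - 2 * (b^T *m M *m a) 0 0 + (b^T *m M *m b) 0 0.
  move=> Ms; have swap : (a^T *m M *m b) 0 0 = (b^T *m M *m a) 0 0.
    have -> : a^T *m M *m b = (b^T *m M *m a)^T by rewrite !trmx_mul !trmxK Ms mulmxA.
    by rewrite mxE.
  have -> : (a - b)^T = a^T - b^T by rewrite linearB.
  rewrite !mulmxBl !mulmxBr; move: swap.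
  have sub00 (A B : 'M[R]_1) : (A - B) 0 0 = A 0 0 - B 0 0 by rewrite !mxE.
  rewrite !sub00 => ->; ring.
have i1s : (invmx D1)^T = invmx D1 by apply: trmx_invmx_sym; case: (tSigma_posdef true).
have i0s : (invmx D0)^T = invmx D0 by apply: trmx_invmx_sym; case: (tSigma_posdef false).
(* This is the square root of [\det D0 / \det D1], the ratio of the two normalizing constants; it
   accounts for the determinant term of [ccg_c]. *)
pose e := expR (2^-1 * ln (\det D0 / \det D1)).
have e0 : 0 < e := expR_gt0 _.
have e2 : e ^+ 2 * \det D1 = \det D0.
  by rewrite -expRM_natl mulrA mulfV// mul1r lnK ?divfK ?gt_eqF// posrE divr_gt0.
pose K := (2 * pi) ^+ d : R.
have K0 : 0 < K by rewrite exprn_gt0// mulr_gt0 ?pi_gt0.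
pose N1 := Num.sqrt (K * \det D1).
have N10 : 0 < N1 by rewrite sqrtr_gt0 mulr_gt0.
have N0E : Num.sqrt (K * \det D0) = e * N1.
  by rewrite -e2 mulrCA sqrtrM ?sqr_ge0// sqrtr_sqr gtr0_norm.
rewrite /multinormal_pdf -/K -/D1 -/D0 N0E -/N1 !quadB//.
have -> : log_odds x =
    (- ((x^T *m invmx D1 *m x) 0 0 - 2 * ((mu true)^T *m invmx D1 *m x) 0 0
        + ((mu true)^T *m invmx D1 *m mu true) 0 0) / 2)
    - (- ((x^T *m invmx D0 *m x) 0 0 - 2 * ((mu false)^T *m invmx D0 *m x) 0 0
        + ((mu false)^T *m invmx D0 *m mu false) 0 0) / 2)
    + 2^-1 * ln (\det D0 / \det D1) + ln (p / (1 - p)).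
  rewrite /log_odds /ccg_A /ccg_b /ccg_c -/D1 -/D0.
  have -> : (invmx D1 *m mu true - invmx D0 *m mu false)^T =
      (mu true)^T *m invmx D1 - (mu false)^T *m invmx D0.
    by rewrite linearB/= !trmx_mul i1s i0s.
  rewrite -scalemxAr -scalemxAl mulmxBr !mulmxBl.
  have sub00 (A B : 'M[R]_1) : (A - B) 0 0 = A 0 0 - B 0 0 by rewrite !mxE.
  have scale00 a (A : 'M[R]_1) : (a *: A) 0 0 = a * A 0 0 by rewrite !mxE.
  by rewrite scale00 !sub00; field.
rewrite !expRD lnK ?posrE ?divr_gt0// -/e expRN.
set E1 := expR _; set E0 := expR _.
have E00 : 0 < E0 := expR_gt0 _.
by field; rewrite !gt_eqF.
Qed.

(** Bayes' rule: the factor in parentheses is the mixture density of the two classes. *)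
Lemma posterior x : 
  p * multinormal_pdf (mu true) (tSigma sigma Sigma true) x =
  sigmoid (log_odds x) *
    (p * multinormal_pdf (mu true) (tSigma sigma Sigma true) x +
     (1 - p) * multinormal_pdf (mu false) (tSigma sigma Sigma false) x).
Proof.
rewrite log_oddsP sigmoidE; have := expR_gt0 (log_odds x).
by set e := expR (log_odds x); move=> e0; field; rewrite gt_eqF// addr_gt0.
Qed.

Lemma measurable_log_odds : measurable_fun setT log_odds.
Proof. exact: measurable_quadratic. Qed.

End log_odds.

(** * The best affine approximation of the log odds *)

Section best_linear_approximation.
Variables (R : realType) (d : nat) (p sigma : R).
Variables (mu : bool -> 'cV[R]_d) (Sigma : bool -> 'M[R]_d).
Variables (B Q : bool -> 'M[R]_d) (lambda : bool -> 'rV[R]_d).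
Hypothesis p01 : 0 < p < 1.
Hypothesis tSigma_posdef : forall k, posdefmx (tSigma sigma Sigma k).
Hypothesis B_sqrt : forall k, is_sqrtmx (B k) (tSigma sigma Sigma k).
Hypothesis Q_orthogonal : forall k, (Q k)^T *m Q k = 1%:M.
Hypothesis Q_diag : forall k,
  (Q k)^T *m (B k *m ccg_A sigma Sigma *m B k) *m Q k = diag_mx (lambda k).

Local Notation A := (ccg_A sigma Sigma).
Local Notation b := (ccg_b sigma mu Sigma).
Local Notation D := (tSigma sigma Sigma).
Local Notation M := (ccg_M p sigma mu Sigma lambda).
Local Notation V := (ccg_V sigma mu Sigma B Q lambda).

Let entryD (X Y : 'M[R]_1) : (X + Y) 0 0 = X 0 0 + Y 0 0. Proof. by rewrite mxE. Qed.
Let entryN (X : 'M[R]_1) : (- X) 0 0 = - X 0 0. Proof. by rewrite mxE. Qed.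
Let entryZ c (X : 'M[R]_1) : (c *: X) 0 0 = c * X 0 0. Proof. by rewrite mxE. Qed.
Let entryM (X Y : 'M[R]_1) : (X *m Y) 0 0 = X 0 0 * Y 0 0.
Proof. by rewrite mxE big_ord1. Qed.
Let entryT (X : 'M[R]_1) : X^T 0 0 = X 0 0. Proof. by rewrite mxE. Qed.

Lemma ccg_A_sym : A^T = A.
Proof.
have Ds k : (D k)^T = D k by case: (tSigma_posdef k).
by rewrite /ccg_A linearZ/= linearB/= !trmx_invmx_sym.
Qed.

Let Q_inv k : Q k *m (Q k)^T = 1%:M.
Proof. exact: mulmx1C. Qed.

(** Orthogonality of [Q k], cyclicity of the trace and [B k *m B k = D k] eliminate the chosen
    diagonalization. The sum of squares below is treated in the same way. *)
Lemma ccg_lambda_sum k : \sum_(j < d) lambda k 0 j = \tr (A *m D k).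
Proof.
rewrite -mxtrace_diag -Q_diag mxtrace_mulC !mulmxA Q_inv mul1mx.
by rewrite mxtrace_mulC mulmxA (B_sqrt k).2 mxtrace_mulC.
Qed.

Lemma ccg_lambda_sum_sqr k :
  \sum_(j < d) lambda k 0 j ^+ 2 = \tr (A *m D k *m (A *m D k)).
Proof.
have -> : \sum_(j < d) lambda k 0 j ^+ 2 = \tr (diag_mx (lambda k) *m diag_mx (lambda k)).
  rewrite /mxtrace; apply: eq_bigr => j _.
  by rewrite mul_diag_mx !mxE eqxx mulr1n expr2.
rewrite -Q_diag; set N := B k *m A *m B k.
have -> : (Q k)^T *m N *m Q k *m ((Q k)^T *m N *m Q k) = (Q k)^T *m (N *m N) *m Q k.
  by rewrite !mulmxA -(mulmxA _ (Q k) (Q k)^T) Q_inv mulmx1.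
rewrite [LHS]mxtrace_mulC [Q k *m _]mulmxA Q_inv mul1mx /N -(B_sqrt k).2.
by rewrite -!mulmxA [LHS]mxtrace_mulC -!mulmxA.
Qed.

(** The gradient of the log odds at [mu k]. Within class [k], the covariance of the log odds with
    the features is [D k *m v k]. *)
Let v k : 'cV[R]_d := b + 2 *: (A *m mu k).

Lemma ccg_u_sum_sqr k :
  \sum_(j < d) ccg_u sigma mu Sigma B Q k j 0 ^+ 2 = ((v k)^T *m D k *m v k) 0 0.
Proof.
set u := ccg_u _ _ _ _ _ k; have -> : \sum_(j < d) u j 0 ^+ 2 = (u^T *m u) 0 0.
  by rewrite [RHS]mxE; apply: eq_bigr => j _; rewrite [u^T _ _]mxE expr2.
have Bs : (B k)^T = B k by case: (B_sqrt k) => -[].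
rewrite /u /ccg_u -/(v k) trmx_mul (trmx_mul _ (B k)) trmxK Bs -(B_sqrt k).2.
by rewrite !mulmxA -(mulmxA _ (Q k) (Q k)^T) Q_inv mulmx1.
Qed.

(** This is the variance part of [integral_multinormal_quadratic] for the log odds in class [k]. *)
Lemma ccg_VE k : V k = 2 * \tr (A *m D k *m (A *m D k)) + ((v k)^T *m D k *m v k) 0 0.
Proof.
by rewrite /ccg_V big_split/= -mulr_sumr ccg_lambda_sum_sqr ccg_u_sum_sqr.
Qed.

Let vT k : (v k)^T = b^T + 2 *: ((mu k)^T *m A).
Proof. by rewrite /v linearD/= linearZ/= trmx_mul ccg_A_sym. Qed.

Let swap (X : 'M[R]_d) (x y : 'cV[R]_d) : X^T = X ->
  (x^T *m X *m y) 0 0 = (y^T *m X *m x) 0 0.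
Proof. by move=> Xs; rewrite -entryT !trmx_mul !trmxK Xs mulmxA. Qed.

Let inner_swap (x y : 'cV[R]_d) : (x^T *m y) 0 0 = (y^T *m x) 0 0.
Proof. by rewrite -entryT trmx_mul trmxK. Qed.

(** The law of total covariance for the log odds and [a^T x]: two within-class terms, and one
    between the class means. *)
Lemma ccg_COV_mul (a : 'cV[R]_d) : (ccg_COV p sigma mu Sigma *m a) 0 0 =
  p * ((v true)^T *m D true *m a) 0 0 + (1 - p) * ((v false)^T *m D false *m a) 0 0 +
  p * (1 - p) * (M true - M false) * (((mu true)^T *m a) 0 0 - ((mu false)^T *m a) 0 0).
Proof.
rewrite /ccg_M !ccg_lambda_sum !vT /ccg_COV /mu_diff.
move: (ccg_A _ _) (ccg_b _ _ _) (ccg_c _ _ _ _) => A' b' c'; rewrite /tSigma.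
move: (mu true) (mu false) (Sigma true) (Sigma false) => m1 m0 S1 S0.
have vD (X Y : 'cV[R]_d) : (X + Y)^T = X^T + Y^T by rewrite linearD.
have vN (X : 'cV[R]_d) : (- X)^T = - X^T by rewrite linearN.
have vZ c (X : 'cV[R]_d) : (c *: X)^T = c *: X^T by rewrite linearZ.
have mulZl c m n q (X : 'M[R]_(m, n)) (Y : 'M[R]_(n, q)) : (c *: X) *m Y = c *: (X *m Y).
  by rewrite scalemxAl.
have mulZr c m n q (X : 'M[R]_(m, n)) (Y : 'M[R]_(n, q)) : X *m (c *: Y) = c *: (X *m Y).
  by rewrite scalemxAr.
rewrite !(vD, vN, vZ) !(mulmxDr, mulmxDl, mulmxN, mulNmx, mulZl, mulZr) ?mulmxA.
rewrite !(mul_mx_scalar, mulZl, mxtraceD, mxtraceZ, raddfN) /=.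
rewrite -!mulmxA !(entryD, entryN, entryZ).
have rank1 (x y : 'cV[R]_d) : (b'^T *m (x *m (y^T *m a))) 0 0 = (b'^T *m x) 0 0 * (y^T *m a) 0 0.
  by rewrite mulmxA entryM.
by rewrite !rank1; ring.
Qed.

(** The law of total variance for [a^T x]. It also shows that [ccg_VAR2] is positive definite, since
    the within-class terms already are. *)
Lemma ccg_VAR2_quad (a : 'cV[R]_d) :
  (a^T *m ccg_VAR2 p sigma mu Sigma *m a) 0 0 =
  p * (a^T *m D true *m a) 0 0 + (1 - p) * (a^T *m D false *m a) 0 0 +
  p * (1 - p) * (((mu true)^T *m a) 0 0 - ((mu false)^T *m a) 0 0) ^+ 2.
Proof.
have -> : ((mu true)^T *m a) 0 0 - ((mu false)^T *m a) 0 0 = ((mu_diff mu)^T *m a) 0 0.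
  by rewrite /mu_diff [in RHS]linearB/= mulmxBl entryD entryN.
rewrite /ccg_VAR2 /tSigma; move: (mu_diff mu) => m.
have rank1 (x : 'cV[R]_d) : (a^T *m (x *m x^T) *m a) 0 0 = ((x^T *m a) 0 0) ^+ 2.
  by rewrite mulmxA -mulmxA entryM (inner_swap a) expr2.
rewrite !(mulmxDr, mulmxDl) -!scalemxAr -!scalemxAl !(entryD, entryZ) rank1.
ring.
Qed.

Lemma ccg_VAR2_posdef : posdefmx (ccg_VAR2 p sigma mu Sigma).
Proof.
have /andP[p0 p1] := p01; have pb0 : 0 < 1 - p by rewrite subr_gt0.
split.
  have Ss k : (Sigma k)^T = Sigma k.
    have [] := tSigma_posdef k; rewrite /tSigma linearD/= tr_scalar_mx => /addIr //.
  have vD (X Y : 'M[R]_d) : (X + Y)^T = X^T + Y^T by rewrite linearD.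
  have vZ c (X : 'M[R]_d) : (c *: X)^T = c *: X^T by rewrite linearZ.
  by rewrite /ccg_VAR2 !(vD, vZ) tr_scalar_mx trmx_mul trmxK !Ss.
move=> x x0; rewrite ccg_VAR2_quad.
have q0 k : 0 < (x^T *m D k *m x) 0 0 by case: (tSigma_posdef k) => _; apply.
apply: ltr_pwDl; first by rewrite addr_gt0// mulr_gt0.
by rewrite mulr_ge0 ?sqr_ge0// mulr_ge0// ltW.
Qed.

(** The regression slope; the intercept [b'] is the mixture mean of the log odds minus [a^T x], so
    that the residual has mean zero. *)
Let a := invmx (ccg_VAR2 p sigma mu Sigma) *m (ccg_COV p sigma mu Sigma)^T.
Let b' := p * (M true - (a^T *m mu true) 0 0) + (1 - p) * (M false - (a^T *m mu false) 0 0).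

(** The second moment of the residual in class [k], as given by [integral_multinormal_quadratic]
    with linear coefficient [b - a] and constant [c - b']. *)
Let moment k :=
  (\tr (A *m D k) + ((mu k)^T *m A *m mu k) 0 0 + ((b - a)^T *m mu k) 0 0 +
   (ccg_c p sigma mu Sigma - b')) ^+ 2 +
  2 * \tr (A *m D k *m (A *m D k)) +
  ((b - a + 2 *: (A *m mu k))^T *m D k *m (b - a + 2 *: (A *m mu k))) 0 0.

(* The least-squares normal equations: [a] and [b'] minimize the mean square of
   the difference between the log odds and [x |-> a^T x + b']. *)
Lemma epsilon_CCGE :
  4^-1 * (p * moment true + (1 - p) * moment false) =
  epsilon_CCG p sigma mu Sigma B Q lambda.
Proof.
have Vp := ccg_VAR2_posdef; have uV := posdefmx_unit Vp.
have aT : a^T = ccg_COV p sigma mu Sigma *m invmx (ccg_VAR2 p sigma mu Sigma).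
  by rewrite /a trmx_mul trmxK trmx_invmx_sym; case: Vp.
have COVa := ccg_COV_mul a; have VARa := ccg_VAR2_quad a.
have VC : (a^T *m ccg_VAR2 p sigma mu Sigma *m a) 0 0 = (ccg_COV p sigma mu Sigma *m a) 0 0.
  by rewrite aT -(mulmxA _ (invmx _)) mulVmx// mulmx1.
have ME k : \tr (A *m D k) + ((mu k)^T *m A *m mu k) 0 0 + ((b - a)^T *m mu k) 0 0 +
    (ccg_c p sigma mu Sigma - b') = M k - ((mu k)^T *m a) 0 0 - b'.
  rewrite /ccg_M ccg_lambda_sum (inner_swap (mu k) a).
  have -> : (b - a)^T = b^T - a^T by rewrite linearB.
  by rewrite mulmxBl entryD entryN; ring.
have qE k : ((b - a + 2 *: (A *m mu k))^T *m D k *m (b - a + 2 *: (A *m mu k))) 0 0 =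
    ((v k)^T *m D k *m v k) 0 0 - 2 * ((v k)^T *m D k *m a) 0 0 + (a^T *m D k *m a) 0 0.
  have -> : b - a + 2 *: (A *m mu k) = v k - a by rewrite /v addrAC.
  have -> : (v k - a)^T = (v k)^T - a^T by rewrite linearB.
  rewrite !mulmxBl !mulmxBr !(entryD, entryN) (@swap (D k) a (v k)); last first.
    by case: (tSigma_posdef k).
  ring.
have momentE k : moment k = (M k - ((mu k)^T *m a) 0 0 - b') ^+ 2 +
    2 * \tr (A *m D k *m (A *m D k)) + (((v k)^T *m D k *m v k) 0 0
    - 2 * ((v k)^T *m D k *m a) 0 0 + (a^T *m D k *m a) 0 0).
  by rewrite /moment ME qE.
have CCE : (ccg_COV p sigma mu Sigma *m invmx (ccg_VAR2 p sigma mu Sigma) *m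
    (ccg_COV p sigma mu Sigma)^T) 0 0 = (ccg_COV p sigma mu Sigma *m a) 0 0.
  by rewrite -mulmxA.
rewrite /epsilon_CCG /ccg_VAR1 CCE !momentE !ccg_VE COVa /b' !(inner_swap a).
(* The mean square contains [- 2 COV a + a^T VAR2 a], the bound only [- COV a]. The sides thus
   differ by a quarter of the normal equation [VC], and what remains is a polynomial identity. *)
move/eqP: VC; rewrite -subr_eq0 VARa COVa => /eqP VC.
apply/eqP; rewrite -subr_eq0 -(mulr0 4^-1) -VC; apply/eqP.
move: (M true) (M false) (\tr _) (\tr _) => M1 M0 t1 t0.
move: (fun_of_matrix _ 0 0) (fun_of_matrix _ 0 0) => ma1 ma0.
ring.
Qed.

Lemma best_affine_approximation :
  exists (a : 'cV[R]_d) (b' : R),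
  let sq k := (\int[lebesgue_cV R d]_x
    (((log_odds p sigma mu Sigma x - ((a^T *m x) 0%R 0%R + b')) ^+ 2)%R%:E *
     (multinormal_pdf (mu k) (D k) x)%:E))%E in
  (p%:E * sq true + (1 - p)%:E * sq false =
   (4 * epsilon_CCG p sigma mu Sigma B Q lambda)%R%:E)%E.
Proof.
exists a, b' => sq; have sqE k : sq k = (moment k)%:E.
  rewrite /moment -(integral_multinormal_quadratic _ _ _ (tSigma_posdef k) ccg_A_sym).
  apply: eq_integral => x _; congr (_ * _)%E; congr (_ ^+ 2)%R%:E.
  have -> : (b - a)^T = b^T - a^T by rewrite linearB.
  by rewrite /log_odds mulmxBl entryD entryN; ring.
by rewrite !sqE -!EFinM -EFinD -epsilon_CCGE mulrA mulfV// mul1r.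
Qed.

End best_linear_approximation.

(** * Risk decomposition *)

Section risk.
Context {disp : measure_display} {T : measurableType disp} {R : realType}
  (P : probability T R).
Variables (d : nat) (p sigma : R) (mu : bool -> 'cV[R]_d) (Sigma : bool -> 'M[R]_d).
Variables (S : {RV P >-> bool}) (X Z : {RV P >-> 'cV[R]_d}).
Hypothesis p01 : 0 < p < 1.
Hypothesis sigma0 : 0 < sigma.
Hypothesis Sigma_posdef : forall k, posdefmx (Sigma k).
Hypothesis S_law : forall A, distribution P S A = bernoulli_prob p A.
Hypothesis X_law : forall (k : bool) A, measurable A ->
  cond_prob P (X @^-1` A) (S @^-1` [set k]) = multinormal_prob (mu k) (Sigma k) A.
Hypothesis Z_law : forall A, measurable A ->
  distribution P Z A = multinormal_prob 0 1%:M A.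
Hypothesis XSZ_independent : independent_RVs P (fun w => (X w, S w)) Z.

Let Xsigma := fun w : T => X w + sigma *: Z w.
Let S01 := fun w : T => (S w)%:R : R.
Let f k := multinormal_pdf (mu k) (tSigma sigma Sigma k).
Let g x := p * f true x + (1 - p) * f false x.

Definition posterior_mean (x : 'cV[R]_d) : R := sigmoid (log_odds p sigma mu Sigma x).
Local Notation eta0 := posterior_mean.

Let tSigma_posdef k : posdefmx (tSigma sigma Sigma k).
Proof. by apply: posdefmxD => //; apply: posdefmx_scalar; rewrite exprn_gt0. Qed.

Let eta0_g x : p * f true x = eta0 x * g x.
Proof. exact: posterior. Qed.

Let eta0_gC x : (1 - p) * f false x = (1 - eta0 x) * g x.
Proof. by rewrite [RHS]mulrBl mul1r -eta0_g /g addrAC subrr add0r. Qed.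

Lemma measurable_posterior_mean : measurable_fun setT eta0.
Proof. exact: (measurableT_comp (@measurable_sigmoid R) (measurable_log_odds _ _ _ _)). Qed.

Let f_ge0 k x : 0 <= f k x. Proof. exact: multinormal_pdf_ge0. Qed.
Let p_ge0 : 0 <= p. Proof. by case/andP: p01 => /ltW. Qed.
Let pC_ge0 : 0 <= 1 - p. Proof. by case/andP: p01 => _ /ltW; rewrite subr_ge0. Qed.
Let g_ge0 x : 0 <= g x. Proof. by rewrite addr_ge0// mulr_ge0. Qed.
Let mf k : measurable_fun setT (f k). Proof. exact: measurable_multinormal_pdf. Qed.
Let mXs : measurable_fun setT Xsigma. Proof. exact: measurable_Xsigma. Qed.

Local Open Scope ereal_scope.

Let integral_label := ge0_integral_label p01 sigma0 Sigma_posdef S_law X_law Z_law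
  XSZ_independent.

Let indic_label w k : \1_(S @^-1` [set k]) w = ((S w == k)%:R : R).
Proof.
rewrite indicE; congr (_%:R); congr nat_of_bool.
by apply/idP/eqP => [/set_mem//|Sk]; exact/mem_set.
Qed.

(** The joint law of the label and [Xsigma]: by Bayes' rule the weighted class densities are
    [eta0 * g] and [(1 - eta0) * g]. Suitable [F0] and [F1] yield the marginal law, the risk, and
    the defining property of the conditional expectation. *)
Let integral_Xsigma (F0 F1 : 'cV[R]_d -> R) :
  measurable_fun setT F0 -> measurable_fun setT F1 ->
  (forall x, 0 <= F0 x)%R -> (forall x, 0 <= F1 x)%R ->
  \int[P]_w (if S w then F1 (Xsigma w) else F0 (Xsigma w))%:E =
  \int[lebesgue_cV R d]_x ((F1 x * eta0 x + F0 x * (1 - eta0 x)) * g x)%:E.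
Proof.
move=> mF0 mF1 F0_ge0 F1_ge0.
have mSk k : measurable_fun setT (fun w => (\1_(S @^-1` [set k]) w : R)).
  by apply: measurable_indic; exact: measurable_funPTI.
have split1 k (F : 'cV[R]_d -> R) : measurable_fun setT F -> (forall x, 0 <= F x)%R ->
   measurable_fun setT (fun w => (F (Xsigma w))%:E * (\1_(S @^-1` [set k]) w)%:E).
  move=> mF _; apply/measurable_EFinP/measurable_funM => //.
  exact: (measurableT_comp mF mXs).
transitivity (\int[P]_w ((F1 (Xsigma w))%:E * (\1_(S @^-1` [set true]) w)%:E +
   (F0 (Xsigma w))%:E * (\1_(S @^-1` [set false]) w)%:E)).
  apply: eq_integral => w _; rewrite !indic_label.
  by case: (S w); rewrite /= ?mule1 ?mule0 ?adde0 ?add0e.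
have mFf k (F : 'cV[R]_d -> R) : measurable_fun setT F ->
    measurable_fun setT (fun x => (F x)%:E * (f k x)%:E).
  by move=> mF; apply/measurable_EFinP; exact: measurable_funM.
have Ff0 k (F : 'cV[R]_d -> R) : (forall x, 0 <= F x)%R ->
    forall x, setT x -> 0 <= (F x)%:E * (f k x)%:E.
  by move=> F_ge0 x _; rewrite -EFinM lee_fin mulr_ge0.
have EF (F : 'cV[R]_d -> R) : measurable_fun setT F ->
    measurable_fun setT (fun x => (F x)%:E) by move/measurable_EFinP.
have F0' (F : 'cV[R]_d -> R) : (forall x, 0 <= F x)%R -> forall x, 0 <= (F x)%:E by [].
rewrite ge0_integralD.
- rewrite (integral_label true (EF _ mF1) (F0' _ F1_ge0)).
  rewrite (integral_label false (EF _ mF0) (F0' _ F0_ge0)).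
  rewrite -/(f true) -/(f false) -(ge0_integralZl_EFin _ measurableT (Ff0 true _ F1_ge0) (mFf true _ mF1) p_ge0).
  rewrite -(ge0_integralZl_EFin _ measurableT (Ff0 false _ F0_ge0) (mFf false _ mF0) pC_ge0).
  rewrite -ge0_integralD.
  + apply: eq_integral => x _; rewrite -!EFinM -EFinD; congr EFin.
    rewrite mulrCA eta0_g [X in (_ + X)%R]mulrCA eta0_gC; ring.
  + exact: measurableT.
  + by move=> x _; rewrite -!EFinM lee_fin !mulr_ge0.
  + by apply: measurable_funeM; exact: mFf.
  + by move=> x _; rewrite -!EFinM lee_fin !mulr_ge0.
  + by apply: measurable_funeM; exact: mFf.
- exact: measurableT.
- by move=> w _; rewrite -EFinM lee_fin mulr_ge0.
- exact: split1.
- by move=> w _; rewrite -EFinM lee_fin mulr_ge0.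
- exact: split1.
Qed.

Let integral_Xsigma_marginal (F : 'cV[R]_d -> R) :
  measurable_fun setT F -> (forall x, 0 <= F x)%R ->
  \int[P]_w (F (Xsigma w))%:E = \int[lebesgue_cV R d]_x (F x * g x)%:E.
Proof.
move=> mF F0; have := integral_Xsigma mF mF F0 F0.
under [in X in X = _ -> _]eq_integral do rewrite if_same.
move=> ->; apply: eq_integral => x _; congr EFin; ring.
Qed.

Lemma measurable_logistic h : logistic_class R d h -> measurable_fun setT h.
Proof.
move=> [a [b ->]]; apply: (measurableT_comp (@measurable_sigmoid R)).
apply: measurable_funD => //; apply: measurable_fun_entry.
by apply: measurable_mulmx; [exact: measurable_cst|exact: measurable_id].
Qed.

(* Conditionally on [Xsigma = x] the risk is
   [eta0 (1 - h)^2 + (1 - eta0) h^2 = (eta0 - h)^2 + eta0 (1 - eta0)]. *)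
Lemma sq_riskE (h : 'cV[R]_d -> R) : measurable_fun setT h ->
  sq_risk P S01 Xsigma h =
  \int[P]_w ((eta0 (Xsigma w) - h (Xsigma w)) ^+ 2)%R%:E +
  \int[P]_w (eta0 (Xsigma w) * (1 - eta0 (Xsigma w)))%R%:E.
Proof.
move=> mh; have me := measurable_posterior_mean.
have e0 x : (0 <= eta0 x)%R by exact: sigmoid_ge0.
have e1 x : (0 <= 1 - eta0 x)%R by rewrite subr_ge0; exact: sigmoid_le1.
have md : measurable_fun setT (fun x => ((eta0 x - h x) ^+ 2)%R).
  by apply: measurable_funX; exact: measurable_funB.
have mv : measurable_fun setT (fun x => (eta0 x * (1 - eta0 x))%R).
  by apply: measurable_funM => //; exact: measurable_funB.
rewrite (integral_Xsigma_marginal md) => [|x]; last exact: sqr_ge0.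
rewrite (integral_Xsigma_marginal mv) => [|x]; last exact: mulr_ge0.
have m0 : measurable_fun setT (fun x => (h x ^+ 2)%R) by exact: measurable_funX.
have m1 : measurable_fun setT (fun x => ((1 - h x) ^+ 2)%R).
  by apply: measurable_funX; exact: measurable_funB.
have := integral_Xsigma m0 m1 (fun x => sqr_ge0 _) (fun x => sqr_ge0 _).
rewrite /sq_risk unlock => RE.
transitivity (\int[P]_w (if S w then ((1 - h (Xsigma w)) ^+ 2)%R else (h (Xsigma w) ^+ 2)%R)%:E).
  apply: eq_integral => w _; rewrite /S01; case: (S w) => //=.
  by rewrite sub0r sqrrN.
have mg : measurable_fun setT g by apply: measurable_funD; exact: measurable_funM.
rewrite RE -ge0_integralD.
- apply: eq_integral => x _; rewrite -EFinD; congr EFin; ring.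
- exact: measurableT.
- by move=> x _; rewrite lee_fin mulr_ge0// sqr_ge0.
- by apply/measurable_EFinP; exact: measurable_funM.
- by move=> x _; rewrite lee_fin !mulr_ge0.
- by apply/measurable_EFinP; exact: measurable_funM.
Qed.

(** Both [eta] and [eta0] have the same integral over every measurable set for the law [nu] of
    [Xsigma], hence agree [nu]-almost everywhere. The comparison is made on the space of features
    because the defining property of [eta] only tests preimages under [Xsigma]. *)
Lemma approximation_errorE (eta h : 'cV[R]_d -> R) :
  is_cond_expectation P S01 Xsigma eta -> measurable_fun setT h ->
  approximation_error P Xsigma eta h =
  \int[P]_w ((eta0 (Xsigma w) - h (Xsigma w)) ^+ 2)%R%:E.
Proof.
move=> [meta ieta etaE] mh; have me := measurable_posterior_mean.
have e0 x : (0 <= eta0 x)%R by exact: sigmoid_ge0.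
pose Xs : {RV P >-> 'cV[R]_d} := HB.pack Xsigma (isMeasurableFun.Build _ _ _ _ _ mXs).
pose nu := distribution P Xs.
have nuE (F : 'cV[R]_d -> \bar R) : measurable_fun setT F -> (forall x, 0 <= F x) ->
    \int[nu]_x F x = \int[P]_w F (Xsigma w).
  move=> mF F0; have := @ge0_integral_pushforward _ _ _ _ R _ mXs P setT F measurableT mF
    (fun x _ => F0 x).
  by rewrite preimage_setT.
have meta' : measurable_fun setT (fun x => (eta x)%:E) by exact/measurable_EFinP.
have me' : measurable_fun setT (fun x => (eta0 x)%:E) by exact/measurable_EFinP.
have ieta' : nu.-integrable setT (fun x => (eta x)%:E).
  apply: (integrable_pushforward mXs meta' _ measurableT).
  by rewrite preimage_setT.
have int_eq B : measurable B -> \int[nu]_(x in B) (eta x)%:E = \int[nu]_(x in B) (eta0 x)%:E.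
  move=> mB; have mXB : measurable (Xsigma @^-1` B).
    by rewrite -[X in measurable X]setTI; exact: mXs.
  have m1 : measurable_fun setT (\1_B : 'cV[R]_d -> R) by exact: measurable_indic.
  have m1e : measurable_fun setT (fun x => (\1_B x * eta0 x)%R) by exact: measurable_funM.
  have indicB (F : T -> \bar R) :
      \int[P]_(w in Xsigma @^-1` B) F w = \int[P]_w ((\1_B (Xsigma w))%:E * F w).
    rewrite integral_mkcond; apply: eq_integral => w _; rewrite patchE indicE.
    rewrite (_ : (w \in _) = (Xsigma w \in B)).
      by case: ifP; rewrite ?mul1e ?mul0e.
    by apply/idP/idP => /set_mem Bw; exact/mem_set.
  have ieta'' : P.-integrable (Xsigma @^-1` B) ((fun x => (eta x)%:E) \o Xsigma).
    exact: (integrableS measurableT mXB (@subsetT _ _) ieta).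
  rewrite (integral_pushforward mXs meta' ieta'' mB) etaE// indicB.
  rewrite (ge0_integral_pushforward mXs P mB (measurable_funTS me')) => [|x _]; last first.
    by rewrite lee_fin.
  rewrite indicB.
  (* With [F0 = 0] and [F1] the indicator of [B], the integrand is the label restricted to [Xsigma]
     in [B]. *)
  have := @integral_Xsigma (cst 0%R) \1_B (measurable_cst _) m1 (fun _ => lexx _).
  move=> /(_ (fun x => ler0n _ _)) E1.
  transitivity (\int[P]_w (if S w then \1_B (Xsigma w) else 0%R)%:E).
    by apply: eq_integral => w _; rewrite -EFinM /S01; case: (S w); rewrite /= ?mulr1 ?mulr0.
  rewrite E1; transitivity (\int[P]_w (\1_B (Xsigma w) * eta0 (Xsigma w))%R%:E); last first.
    by apply: eq_integral => w _; rewrite EFinM.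
  rewrite (integral_Xsigma_marginal m1e) => [|x]; last by rewrite mulr_ge0// ler0n.
  by apply: eq_integral => x _; rewrite mul0r addr0.
have /= ae : ae_eq nu setT (fun x => (eta x)%:E) (fun x => (eta0 x)%:E).
  apply: integral_ae_eq => // B _; exact: int_eq.
have msq (e : 'cV[R]_d -> R) : measurable_fun setT e ->
    measurable_fun setT (fun x => ((e x - h x) ^+ 2)%R%:E).
  by move=> mE; apply/measurable_EFinP/measurable_funX; exact: measurable_funB.
rewrite /approximation_error unlock.
rewrite -(nuE (fun x => ((eta x - h x) ^+ 2)%R%:E) (msq _ meta)); last first.
  by move=> x; rewrite lee_fin sqr_ge0.
rewrite -(nuE (fun x => ((eta0 x - h x) ^+ 2)%R%:E) (msq _ me)); last first.
  by move=> x; rewrite lee_fin sqr_ge0.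
apply: ge0_ae_eq_integral.
- exact: measurableT.
- exact: msq.
- exact: msq.
- by move=> x _; rewrite lee_fin sqr_ge0.
- by move=> x _; rewrite lee_fin sqr_ge0.
- by apply: filterS ae => x /(_ I) [->].
Qed.

Lemma approximation_error_le_CCG (eta hstar : 'cV[R]_d -> R)
    (B Q : bool -> 'M[R]_d) (lambda : bool -> 'rV[R]_d) :
  is_cond_expectation P S01 Xsigma eta ->
  is_risk_minimizer P S01 Xsigma (logistic_class R d) hstar ->
  (forall k, is_sqrtmx (B k) (tSigma sigma Sigma k)) ->
  (forall k, (Q k)^T *m Q k = 1%:M)%R ->
  (forall k, (Q k)^T *m (B k *m ccg_A sigma Sigma *m B k) *m Q k =
             diag_mx (lambda k))%R ->
  approximation_error P Xsigma eta hstar <=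
   (epsilon_CCG p sigma mu Sigma B Q lambda)%:E.
Proof.
move=> etaE [Hh hmin] Bsqrt Qo Qd.
have [a [b' best]] := best_affine_approximation mu p01 tSigma_posdef Bsqrt Qo Qd.
pose l (x : 'cV[R]_d) : R := ((a^T *m x) 0%R 0%R + b')%R.
have Hl : logistic_class R d (sigmoid \o l) by exists a, b'.
have ml : measurable_fun setT l.
  apply: measurable_funD => //; apply: measurable_fun_entry.
  by apply: measurable_mulmx; [exact: measurable_cst|exact: measurable_id].
have mh := measurable_logistic Hh; have mg := measurable_logistic Hl.
have mq := measurable_log_odds p sigma mu Sigma.
have me := measurable_posterior_mean.
rewrite (approximation_errorE etaE mh).
(* The irreducible part of the risk must be finite to be cancelled from an inequality between
   extended reals; its integrand lies in [0, 1]. *)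
have noise : \int[P]_w (eta0 (Xsigma w) * (1 - eta0 (Xsigma w)))%R%:E \is a fin_num.
  have mv : measurable_fun setT (fun w => (eta0 (Xsigma w) * (1 - eta0 (Xsigma w)))%R).
    have meX : measurable_fun setT (eta0 \o Xsigma) by exact: measurableT_comp me mXs.
    by apply: measurable_funM => //; exact: measurable_funB.
  have e01 x : (0 <= eta0 x <= 1)%R by rewrite sigmoid_ge0 sigmoid_le1.
  rewrite ge0_fin_numE; last first.
    by apply: integral_ge0 => w _; rewrite lee_fin; have := e01 (Xsigma w); nra.
  apply: (@le_lt_trans _ _ (\int[P]_w 1)); last first.
    rewrite integral_cst// mul1e.
    exact: le_lt_trans (probability_le1 P measurableT) (ltry 1%R).
  apply: ge0_le_integral.
  - exact: measurableT.
  - by move=> w _; rewrite lee_fin; have := e01 (Xsigma w); nra.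
  - exact/measurable_EFinP.
  - exact: measurable_cst.
  - by move=> w _; rewrite lee_fin; have := e01 (Xsigma w); nra.
(* Minimality of [hstar] against the competitor [sigmoid \o l], after cancelling the irreducible
   part, compares their distances to the posterior. *)
have := hmin _ Hl; rewrite (sq_riskE mh) (sq_riskE mg) leeD2rE// => /le_trans; apply.
pose sq x := (4^-1 * (log_odds p sigma mu Sigma x - l x) ^+ 2)%R.
have msq0 : measurable_fun setT (fun x => ((log_odds p sigma mu Sigma x - l x) ^+ 2)%R).
  by apply: measurable_funX; exact: measurable_funB.
have msq : measurable_fun setT sq by exact: measurable_funM.
have sq0 x : (0 <= sq x)%R by rewrite mulr_ge0 ?sqr_ge0.
apply: (@le_trans _ _ (\int[P]_w (sq (Xsigma w))%:E)).
  apply: ge0_le_integral.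
  - exact: measurableT.
  - by move=> w _; rewrite lee_fin sqr_ge0.
  - apply/measurable_EFinP/(measurableT_comp (f := fun x => ((eta0 x - sigmoid (l x)) ^+ 2)%R) _ mXs).
    by apply: measurable_funX; exact: measurable_funB.
  - exact/measurable_EFinP/(measurableT_comp msq mXs).
  - by move=> w _; rewrite lee_fin; exact: sigmoid_sub_sqr.
rewrite (integral_Xsigma_marginal msq sq0).
rewrite (_ : \int[_]_x _ = (4^-1)%:E * (4 * epsilon_CCG p sigma mu Sigma B Q lambda)%R%:E).
  by rewrite -EFinM mulrA mulVf// mul1r.
rewrite -best /=.
have mFf k : measurable_fun setT (fun x =>
    ((log_odds p sigma mu Sigma x - l x) ^+ 2)%R%:E * (f k x)%:E).
  by apply/measurable_EFinP; exact: measurable_funM.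
have Ff0 k x : setT x -> 0 <= ((log_odds p sigma mu Sigma x - l x) ^+ 2)%R%:E * (f k x)%:E.
  by move=> _; rewrite -EFinM lee_fin mulr_ge0 ?sqr_ge0.
rewrite -(ge0_integralZl_EFin _ measurableT (Ff0 true) (mFf true) p_ge0).
rewrite -(ge0_integralZl_EFin _ measurableT (Ff0 false) (mFf false) pC_ge0).
rewrite -ge0_integralD.
- rewrite -ge0_integralZl_EFin.
  + apply: eq_integral => x _; rewrite -!EFinM; congr EFin.
    rewrite /sq /g; ring.
  + exact: measurableT.
  + by move=> x _; rewrite -!EFinM lee_fin addr_ge0// mulr_ge0// mulr_ge0// sqr_ge0.
  + by apply: emeasurable_funD; apply: measurable_funeM; exact: mFf.
  + by [].
- exact: measurableT.
- by move=> x _; rewrite -!EFinM lee_fin mulr_ge0// mulr_ge0// sqr_ge0.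
- by apply: measurable_funeM; exact: mFf.
- by move=> x _; rewrite -!EFinM lee_fin mulr_ge0// mulr_ge0// sqr_ge0.
- by apply: measurable_funeM; exact: mFf.
Qed.

End risk.

Theorem theorem4 (R : realType) (disp : measure_display)
    (T : measurableType disp) (P : probability T R)
    (d : nat) (p sigma : R)
    (mu : bool -> 'cV[R]_d) (Sigma : bool -> 'M[R]_d)
    (S : {RV P >-> bool}) (X Z : {RV P >-> 'cV[R]_d})
    (eta hstar : 'cV[R]_d -> R)
    (B Q : bool -> 'M[R]_d) (lambda : bool -> 'rV[R]_d) :
  let Xsigma := fun w : T => X w + sigma *: Z w in
  let S01 := fun w : T => (S w)%:R : R in
  (0 < d)%N ->
  0 < p < 1 ->
  0 < sigma ->
  (forall k, posdefmx (Sigma k)) ->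
  (forall A, distribution P S A = bernoulli_prob p A) ->
  (forall (k : bool) A, measurable A ->
     cond_prob P (X @^-1` A) (S @^-1` [set k]) =
     multinormal_prob (mu k) (Sigma k) A) ->
  (forall A, measurable A ->
     distribution P Z A = multinormal_prob 0 1%:M A) ->
  independent_RVs P (fun w => (X w, S w)) Z ->
  is_cond_expectation P S01 Xsigma eta ->
  is_risk_minimizer P S01 Xsigma (logistic_class R d) hstar ->
  (forall k, is_sqrtmx (B k) (tSigma sigma Sigma k)) ->
  (forall k, (Q k)^T *m Q k = 1%:M) ->
  (forall k, (Q k)^T *m (B k *m ccg_A sigma Sigma *m B k) *m Q k =
             diag_mx (lambda k)) ->
  (approximation_error P Xsigma eta hstar <=
   (epsilon_CCG p sigma mu Sigma B Q lambda)%:E)%E.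
Proof.
move=> Xsigma S01 _ p01 sigma0 Sigma_posdef S_law X_law Z_law XSZ_ind.
exact: (approximation_error_le_CCG p01 sigma0 Sigma_posdef S_law X_law Z_law XSZ_ind).
Qed.
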